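(* Let $(X,\mathcal{X},\mu)$ be a $\sigma$-finite measure space and $(\mathcal{E},\mathcal{F})$ a Dirichlet form on $L_2(X,\mu)$. Let $\mathcal{B}:=\{f\in b\mathcal{X}: \text{the }\mu\text{-class of }f\text{ lies in }\mathcal{F}\}$, where $b\mathcal{X}$ denotes the bounded $\mathcal{X}$-measurable real functions, and set $\mathcal{E}(f,g):=\mathcal{E}([f],[g])$ for $f,g\in\mathcal{B}$ (with $[f]$ the $\mu$-class). Then $L_f(h):=2\mathcal{E}(fh,f)-\mathcal{E}(f^2,h)$, $f,h\in\mathcal{B}$, polarized to $L_{f,g}:=\frac14(L_{f+g}-L_{f-g})$, defines a sup-norm-closable Lagrangian $(L,\mathcal{B})$ on which normal contractions operate. Moreover $(\mathcal{E},\mathcal{B})$ is a sup-norm-closable bilinear form on which normal contractions operate.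
   Context: Functions spaces carry the supremum norm $\|f\|_{\sup}=\sup_{x}|f(x)|$; $\mathcal{D}^+$ denotes nonnegative elements. A bilinear form is a symmetric nonnegative definite bilinear map; $\mathcal{E}(f):=\mathcal{E}(f,f)$. It is sup-norm-closable if every $\mathcal{E}$-Cauchy sequence $(f_n)$ with $\|f_n\|_{\sup}\to0$ satisfies $\mathcal{E}(f_n)\to0$. A normal contraction is $F:\mathbb{R}\to\mathbb{R}$ with $F(0)=0$, $|F(x)-F(y)|\le|x-y|$; normal contractions operate on $(\mathcal{E},\mathcal{D})$ if $F(f)\in\mathcal{D}$ and $\mathcal{E}(F(f))\le\mathcal{E}(f)$. Unit contraction: $T_1(x)=\max(x,0)\wedge1$. For an algebra $\mathcal{D}$ of bounded functions with $f\wedge 1\in\mathcal{D}$ for all $f\in\mathcal{D}$, a Lagrangian is a symmetric bilinear map $(f,g)\mapsto L_{f,g}$ from $\mathcal{D}\times\mathcal{D}$ into the dual $\mathcal{D}'$ of $(\mathcal{D},\|\cdot\|_{\sup})$ such that each $L_f:=L_{f,f}$ is positive ($h\ge0\Rightarrow L_f(h)\ge0$) and $L_f-L_{T_1(f)}$ is positive for all $f$. Normal contractions operate on $(L,\mathcal{D})$ if $\mathcal{D}$ is stable under normal contractions and $L_f-L_{F(f)}$ is positive for every $f$ and normal contraction $F$. A Lagrangian is sup-norm-closable if for each $h\in\mathcal{D}^+$ the bilinear form $(f,g)\mapsto L_{f,g}(h)$ is sup-norm-closable. *)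

(* Defs.v *)
From HB Require Import structures.
From mathcomp Require Import all_boot all_order all_algebra.
From mathcomp Require Import all_classical all_reals all_analysis.
Set Implicit Arguments. Unset Strict Implicit. Unset Printing Implicit Defensive.
Import Order.TTheory GRing.Theory Num.Theory.
Local Open Scope classical_set_scope.
Local Open Scope ring_scope.

Section Defs.
Context {R : realType}.

Section Generic.
Context {T : Type}.

Definition bounded_fun (f : T -> R) : Prop := exists M : R, forall x, `|f x| <= M.

Definition normal_contraction (F : R -> R) : Prop :=
  F 0 = 0 /\ forall x y, `|F x - F y| <= `|x - y|.

Definition T1 (x : R) : R := Num.min (Num.max x 0) 1.

Definition is_bilinear_form (D : set (T -> R)) (E : (T -> R) -> (T -> R) -> R) : Prop :=
  [/\ (forall f g, D f -> D g -> E f g = E g f),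
      (forall (a : R) f f' g, D f -> D f' -> D g ->
          E (fun x => a * f x + f' x) g = a * E f g + E f' g)
    & (forall f, D f -> 0 <= E f f)].

Definition sup_norm_closable (D : set (T -> R)) (E : (T -> R) -> (T -> R) -> R) : Prop :=
  forall u : nat -> T -> R, (forall n, D (u n)) ->
    (forall e : R, 0 < e -> exists N, forall n m, (N <= n)%N -> (N <= m)%N ->
        E (fun x => u n x - u m x) (fun x => u n x - u m x) < e) ->
    (forall e : R, 0 < e -> exists N, forall n, (N <= n)%N -> forall x, `|u n x| <= e) ->
    (forall e : R, 0 < e -> exists N, forall n, (N <= n)%N -> `|E (u n) (u n)| < e).

Definition nc_operate_form (D : set (T -> R)) (E : (T -> R) -> (T -> R) -> R) : Prop :=
  forall F f, normal_contraction F -> D f ->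
    D (fun x => F (f x)) /\ E (fun x => F (f x)) (fun x => F (f x)) <= E f f.

Definition bdd_algebra_min1 (D : set (T -> R)) : Prop :=
  [/\ D (fun _ => 0),
      (forall (a : R) f g, D f -> D g -> D (fun x => a * f x + g x)),
      (forall f g, D f -> D g -> D (fun x => f x * g x)),
      (forall f, D f -> bounded_fun f)
    & (forall f, D f -> D (fun x => Num.min (f x) 1))].

Definition in_dual (D : set (T -> R)) (l : (T -> R) -> R) : Prop :=
  (forall (a : R) h h', D h -> D h' -> l (fun x => a * h x + h' x) = a * l h + l h')
  /\ exists C : R, forall h M, D h -> (forall x, `|h x| <= M) -> `|l h| <= C * M.

Definition nonneg_fun (h : T -> R) : Prop := forall x, 0 <= h x.

Definition is_lagrangian (D : set (T -> R)) (L : (T -> R) -> (T -> R) -> (T -> R) -> R)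
  : Prop :=
  bdd_algebra_min1 D /\
  [/\ (forall f g, D f -> D g -> in_dual D (L f g)),
      (forall f g h, D f -> D g -> D h -> L f g h = L g f h),
      (forall (a : R) f f' g h, D f -> D f' -> D g -> D h ->
          L (fun x => a * f x + f' x) g h = a * L f g h + L f' g h),
      (forall f h, D f -> D h -> nonneg_fun h -> 0 <= L f f h)
    & (forall f h, D f -> D h -> nonneg_fun h ->
          L (fun x => T1 (f x)) (fun x => T1 (f x)) h <= L f f h)].

Definition nc_operate_lagr (D : set (T -> R)) (L : (T -> R) -> (T -> R) -> (T -> R) -> R)
  : Prop :=
  (forall F f, normal_contraction F -> D f -> D (fun x => F (f x))) /\
  (forall F f h, normal_contraction F -> D f -> D h -> nonneg_fun h ->
     L (fun x => F (f x)) (fun x => F (f x)) h <= L f f h).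

Definition sup_norm_closable_lagr (D : set (T -> R))
  (L : (T -> R) -> (T -> R) -> (T -> R) -> R) : Prop :=
  forall h, D h -> nonneg_fun h -> sup_norm_closable D (fun f g => L f g h).

Definition lagr_quad (E : (T -> R) -> (T -> R) -> R) (f h : T -> R) : R :=
  2 * E (fun x => f x * h x) f - E (fun x => f x * f x) h.
Definition lagr_of (E : (T -> R) -> (T -> R) -> R) (f g h : T -> R) : R :=
  (lagr_quad E (fun x => f x + g x) h - lagr_quad E (fun x => f x - g x) h) / 4.
End Generic.

Section Dirichlet.
Context {d : measure_display} {T : measurableType d} (mu : {measure set T -> \bar R}).

Definition L2fun (f : T -> R) : Prop :=
  measurable_fun setT f /\ mu.-integrable setT (fun x => ((f x) ^+ 2)%:E).

Definition l2norm2 (f : T -> R) : R := fine (\int[mu]_x ((f x) ^+ 2)%:E).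

(* A Dirichlet form on L_2(X,mu), given through representatives:
   F is a set of square-integrable measurable functions, saturated under
   mu-a.e. equality, E is a form on F not depending on representatives. *)
Definition is_dirichlet_form (F : set (T -> R)) (E : (T -> R) -> (T -> R) -> R) : Prop :=
  [/\ (forall f, F f -> L2fun f),
      (forall f g, F f -> measurable_fun setT g -> ae_eq mu setT f g -> F g),
      F (fun _ => 0),
      (forall (a : R) f g, F f -> F g -> F (fun x => a * f x + g x))
    & (forall f f' g, F f -> F f' -> F g -> ae_eq mu setT f f' -> E f g = E f' g)] /\
  [/\ is_bilinear_form F E,
      (forall g, L2fun g -> forall e : R, 0 < e ->
          exists f, F f /\ l2norm2 (fun x => f x - g x) < e),
      (forall u : nat -> T -> R, (forall n, F (u n)) ->
        (forall e : R, 0 < e -> exists N, forall n m, (N <= n)%N -> (N <= m)%N ->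
            E (fun x => u n x - u m x) (fun x => u n x - u m x)
            + l2norm2 (fun x => u n x - u m x) < e) ->
        exists v, F v /\ forall e : R, 0 < e -> exists N, forall n, (N <= n)%N ->
            E (fun x => u n x - v x) (fun x => u n x - v x)
            + l2norm2 (fun x => u n x - v x) < e)
    &
      (forall f, F f -> F (fun x => T1 (f x)) /\
          E (fun x => T1 (f x)) (fun x => T1 (f x)) <= E f f)].

Definition bdd_part (F : set (T -> R)) : set (T -> R) :=
  fun f => [/\ measurable_fun setT f, bounded_fun f & F f].
End Dirichlet.
End Defs.

(* Main.v *)
Require Import Defs.
From HB Require Import structures.
From mathcomp Require Import all_boot all_order all_algebra.
From mathcomp Require Import all_classical all_reals all_analysis.
From mathcomp Require Import measurable_realfun.
From mathcomp Require Import ring lra.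
Import Order.TTheory GRing.Theory Num.Theory.
Import numFieldNormedType.Exports.
Local Open Scope classical_set_scope.
Local Open Scope ring_scope.
Set Implicit Arguments. Unset Strict Implicit. Unset Printing Implicit Defensive.

(** For b > 0 and g in L2 let [res b g] minimise E(v) + b |v - g|^2 over v in F;
this is b G_b g for the resolvent G_b.  It is a symmetric sub-Markov operator S,
and a^b(f, g) := b <f - S f, g> satisfies a^b(f, f) <= E(f) and a^b -> E on F;
conversely, a g in L2 with sup_b a^b(g, g) < oo lies in F.  Therefore every
assertion that only involves inequalities can be proved for a^b in place of E and
passed to the limit.

For a^b and bounded f the Lagrangian is b <k, Gamma f> with
Gamma f = S(f^2) - 2 f S f + f^2, and the required inequalities between such
functions follow from pointwise inequalities such as
(phi(f(y)) - phi(f(x)))^2 <= (f(y) - f(x))^2 by applying the positive operator S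
in the variable y.

Closability of E: if u_n -> 0 uniformly, then <k, Gamma u_n> -> 0 for every
integrable weight k, so <k, Gamma u_m> is controlled by <k, Gamma (u_m - u_n)> as
n -> oo; weights increasing to the indicator of {u_m != 0} recover a^b(u_m, u_m).
Closability of L(h): if (u_n) is L(h)-Cauchy and u_n -> 0 uniformly, then (u_n h)
is E-Cauchy and tends to 0 in L2, so E(u_n h) -> 0 by closedness and
L_{u_n}(h^2) -> 0.  Finally h <= min(h, t) + h^2 / t, and
L_{u_N}(min(h, t)) <= 2 t E(u_N) is small for small t. *)

Local Ltac fring := apply/funext => ? /=; ring.

(** * Algebra of symmetric nonnegative forms on a vector space of functions *)

Section Form.
Context {R : realType} {T : Type} (D : set (T -> R)).
Context (E : (T -> R) -> (T -> R) -> R).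
Hypothesis D0 : D (fun=> 0).
Hypothesis Dlin : forall (a : R) f g, D f -> D g -> D (fun x => a * f x + g x).
Hypothesis HE : is_bilinear_form D E.

Lemma form_scaleP a f : D f -> D (fun x => a * f x).
Proof.
move=> Df; rewrite (_ : (fun x => _) = (fun x => a * f x + 0)); last by fring.
exact: Dlin.
Qed.

Lemma form_comb a b f g : D f -> D g -> D (fun x => a * f x + b * g x).
Proof. by move=> Df Dg; apply: Dlin => //; exact: form_scaleP. Qed.

Lemma form_addP f g : D f -> D g -> D (fun x => f x + g x).
Proof.
move=> Df Dg; rewrite (_ : (fun x => _) = (fun x => 1 * f x + g x)); last by fring.
exact: Dlin.
Qed.

Lemma form_subP f g : D f -> D g -> D (fun x => f x - g x).
Proof.
move=> Df Dg; rewrite (_ : (fun x => _) = (fun x => -1 * g x + f x)); last by fring.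
exact: Dlin.
Qed.

Lemma formC f g : D f -> D g -> E f g = E g f.
Proof. by case: HE => + _ _; apply. Qed.

Lemma form_ge0 f : D f -> 0 <= E f f.
Proof. by case: HE => _ _; apply. Qed.

Lemma form0l g : D g -> E (fun=> 0) g = 0.
Proof.
case: HE => _ /(_ 1 (fun=> 0) (fun=> 0) g D0 D0) h _ /h.
rewrite (_ : (fun x => _) = (fun=> 0)); last by fring.
lra.
Qed.

Lemma formZl a f g : D f -> D g -> E (fun x => a * f x) g = a * E f g.
Proof.
move=> Df Dg; rewrite (_ : (fun x => _) = (fun x => a * f x + 0)); last by fring.
by case: HE => _ linE _; rewrite linE// form0l// addr0.
Qed.

Lemma formZr a f g : D f -> D g -> E f (fun x => a * g x) = a * E f g.
Proof.
move=> Df Dg; rewrite formC//; last exact: form_scaleP.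
by rewrite formZl// formC.
Qed.

Lemma form_combl a b f g h : D f -> D g -> D h ->
  E (fun x => a * f x + b * g x) h = a * E f h + b * E g h.
Proof.
move=> Df Dg Dh; case: HE => _ linE _.
by rewrite linE ?formZl//; exact: form_scaleP.
Qed.

Lemma form_combr a b f g h : D f -> D g -> D h ->
  E h (fun x => a * f x + b * g x) = a * E h f + b * E h g.
Proof.
move=> Df Dg Dh; rewrite formC//; last exact: form_comb.
by rewrite form_combl// !(formC _ Dh).
Qed.

Lemma formBl f g h : D f -> D g -> D h -> E (fun x => f x - g x) h = E f h - E g h.
Proof.
move=> Df Dg Dh; rewrite (_ : (fun x => _) = (fun x => 1 * f x + (-1) * g x)); last by fring.
by rewrite form_combl//; ring.
Qed.

Lemma formBr f g h : D f -> D g -> D h -> E h (fun x => f x - g x) = E h f - E h g.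
Proof.
move=> Df Dg Dh; rewrite (_ : (fun x => _) = (fun x => 1 * f x + (-1) * g x)); last by fring.
by rewrite form_combr//; ring.
Qed.

Lemma formDl f g h : D f -> D g -> D h -> E (fun x => f x + g x) h = E f h + E g h.
Proof.
move=> Df Dg Dh; rewrite (_ : (fun x => _) = (fun x => 1 * f x + 1 * g x)); last by fring.
by rewrite form_combl//; ring.
Qed.

Lemma formDr f g h : D f -> D g -> D h -> E h (fun x => f x + g x) = E h f + E h g.
Proof.
move=> Df Dg Dh; rewrite (_ : (fun x => _) = (fun x => 1 * f x + 1 * g x)); last by fring.
by rewrite form_combr//; ring.
Qed.

Lemma form_sq a b f g : D f -> D g ->
  E (fun x => a * f x + b * g x) (fun x => a * f x + b * g x) =
  a ^+ 2 * E f f + 2 * a * b * E f g + b ^+ 2 * E g g.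
Proof.
move=> Df Dg; rewrite form_combl//; last exact: form_comb.
by rewrite !form_combr// (formC Dg Df)//; ring.
Qed.

Lemma form_sqB f g : D f -> D g ->
  E (fun x => f x - g x) (fun x => f x - g x) = E f f - 2 * E f g + E g g.
Proof.
move=> Df Dg; rewrite (_ : (fun x => _) = (fun x => 1 * f x + (-1) * g x)); last by fring.
by rewrite form_sq//; ring.
Qed.

Lemma form_subC f g : D f -> D g ->
  E (fun x => f x - g x) (fun x => f x - g x) = E (fun x => g x - f x) (fun x => g x - f x).
Proof. by move=> Df Dg; rewrite !form_sqB// (formC Df Dg); ring. Qed.

(** The difference of the two sides is the value of the form at f - 2 g. *)
Lemma form_le2B f g : D f -> D g ->
  E f f <= 2 * E (fun x => f x - g x) (fun x => f x - g x) + 2 * E g g.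
Proof.
move=> Df Dg; rewrite form_sqB//.
have := form_ge0 (form_comb 1 (-2) Df Dg); rewrite form_sq//; lra.
Qed.

Lemma form_sqB_le f g : D f -> D g ->
  E (fun x => f x - g x) (fun x => f x - g x) <= 2 * E f f + 2 * E g g.
Proof.
move=> Df Dg; rewrite form_sqB//.
have := form_ge0 (form_comb 1 1 Df Dg); rewrite form_sq//; lra.
Qed.

Lemma form_CauchySchwarz f g : D f -> D g -> E f g ^+ 2 <= E f f * E g g.
Proof.
move=> Df Dg; set A := E f f; set B := E f g; set C := E g g.
have h a b : 0 <= a ^+ 2 * A + 2 * a * b * B + b ^+ 2 * C.
  by rewrite -form_sq//; exact/form_ge0/form_comb.
have A0 : 0 <= A by exact: form_ge0.
have [A_eq0|A_gt0] := eqVneq A 0.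
  have [->|B0] := eqVneq B 0; first by rewrite A_eq0 mul0r expr0n.
  (* With A = 0 and b = 1 the quadratic in [h] reduces to 2 a B + C, which equals -1 at this a. *)
  have := h (- (C + 1) / (2 * B)) 1; rewrite A_eq0 mulr0 add0r.
  rewrite (_ : 2 * _ * 1 * B = - (C + 1)); last by field.
  lra.
have {}A_gt0 : 0 < A by rewrite lt_def A_gt0.
(* At a = - B and b = A the quadratic equals A (A C - B^2). *)
have := h (- B) A; rewrite -(pmulr_rge0 _ A_gt0) => h'.
rewrite -subr_ge0 -(pmulr_rge0 _ A_gt0) -(pmulr_rge0 _ A_gt0).
by apply: le_trans h' _; rewrite le_eqVlt; apply/orP; left; apply/eqP; ring.
Qed.

End Form.

(** * Square-integrable functions, their inner product, and cutoffs *)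

HB.lock Definition ip {R : realType} {d : measure_display} {T : measurableType d}
  (mu : {measure set T -> \bar R}) (f g : T -> R) : R := \int[mu]_x (f x * g x).

Section L2.
Context {R : realType} {d : measure_display} {T : measurableType d}.
Context (mu : {measure set T -> \bar R}).
Implicit Types f g h w q : T -> R.

Local Notation ip := (ip mu).

(** Multipliers of L2; unlike [bddL2], this class contains the constants even when mu is
    infinite. *)
Definition bddm f := measurable_fun setT f /\ Defs.bounded_fun f.
Definition bddL2 f := L2fun mu f /\ Defs.bounded_fun f.

Lemma l2norm2E f : l2norm2 mu f = ip f f.
Proof. by rewrite ip.unlock. Qed.

Lemma bddL2_bddm f : bddL2 f -> bddm f.
Proof. by move=> [[]]. Qed.

Lemma le_integrableR f g : measurable_fun setT f -> (forall x, `|f x| <= g x) ->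
  mu.-integrable setT (EFin \o g) -> mu.-integrable setT (EFin \o f).
Proof.
move=> mf fg; apply: le_integrable => //; first exact/measurable_EFinP.
by move=> x _; rewrite /= lee_fin (le_trans (fg x))// ler_norm.
Qed.

Lemma integrable_comb a b f g :
  mu.-integrable setT (EFin \o f) -> mu.-integrable setT (EFin \o g) ->
  mu.-integrable setT (EFin \o (fun x => a * f x + b * g x)).
Proof.
move=> If Ig; have := integrableD measurableT
  (integrableZl measurableT a If) (integrableZl measurableT b Ig).
by congr (_.-integrable _ _).
Qed.

Lemma L2_0 : L2fun mu (fun=> 0).
Proof.
split => //; rewrite (_ : (fun=> _) = cst 0%E); last by apply/funext => x; rewrite expr0n.
exact: integrable0.
Qed.

Lemma L2_lin a f g : L2fun mu f -> L2fun mu g -> L2fun mu (fun x => a * f x + g x).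
Proof.
move=> [mf If] [mg Ig].
have m : measurable_fun setT (fun x => a * f x + g x).
  by apply: measurable_funD => //; exact: measurable_funM.
split => //; apply: (le_integrableR _ _ (integrable_comb (2 * a ^+ 2) 2 If Ig)).
  exact: measurable_funX.
move=> x /=; rewrite ger0_norm ?sqr_ge0//.
have := sqr_ge0 (a * f x - g x); lra.
Qed.

Lemma L2_mul f g : L2fun mu f -> L2fun mu g ->
  mu.-integrable setT (EFin \o (fun x => f x * g x)).
Proof.
move=> [mf If] [mg Ig].
apply: (le_integrableR _ _ (integrable_comb 1 1 If Ig)); first exact: measurable_funM.
move=> x /=; have := sqr_ge0 (f x - g x); have := sqr_ge0 (f x + g x).
by rewrite ler_norml => h1 h2; apply/andP; split; lra.
Qed.

Lemma ip_is_form : is_bilinear_form (L2fun mu) ip.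
Proof.
split.
- by move=> f g _ _; rewrite ip.unlock; apply: eq_Rintegral => x _; rewrite mulrC.
- move=> a f f' g Lf Lf' Lg; rewrite ip.unlock -RintegralZl//; last exact: L2_mul.
  rewrite -RintegralD//; [|exact: (integrableZl measurableT a (L2_mul Lf Lg))|exact: L2_mul].
  by apply: eq_Rintegral => x _; ring.
- by move=> f _; rewrite ip.unlock; apply: Rintegral_ge0 => x _; rewrite -expr2 sqr_ge0.
Qed.

(** The function g - f agrees almost everywhere with its absolute value, whose integral is
    nonnegative. *)
Lemma ae_le_Rintegral f g : mu.-integrable setT (EFin \o f) ->
  mu.-integrable setT (EFin \o g) -> {ae mu, forall x, f x <= g x} ->
  \int[mu]_x f x <= \int[mu]_x g x.
Proof.
move=> If Ig fg; rewrite -subr_ge0 -RintegralB//.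
have mk : measurable_fun setT (fun x => g x - f x).
  by apply: measurable_funB; apply/measurable_EFinP; [case/integrableP: Ig|case/integrableP: If].
rewrite /Rintegral (ae_eq_integral (fun x => (`|g x - f x|)%:E))//.
- by apply: (@Rintegral_ge0 _ _ _ mu setT (fun x => `|g x - f x|)).
- exact/measurable_EFinP.
- by apply/measurable_EFinP; exact: measurableT_comp.
- by apply: filterS fg => x fg _; rewrite ger0_norm// subr_ge0.
Qed.

Lemma ip_mono f f' g g' : L2fun mu f -> L2fun mu f' -> L2fun mu g -> L2fun mu g' ->
  {ae mu, forall x, f x * g x <= f' x * g' x} -> ip f g <= ip f' g'.
Proof. by move=> Lf Lf' Lg Lg'; rewrite ip.unlock; apply: ae_le_Rintegral; exact: L2_mul. Qed.

Lemma ip_mulC f g h : ip (fun x => f x * g x) h = ip g (fun x => f x * h x).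
Proof. by rewrite ip.unlock; apply: eq_Rintegral => x _; ring. Qed.

Lemma ip_eq0 f : L2fun mu f -> ip f f <= 0 -> ae_eq mu setT f (fun=> 0).
Proof.
move=> Lf; have ip0 : 0 <= ip f f by case: ip_is_form => _ _; apply.
move=> ff0; have /eqP {}ff0 : ip f f == 0 by rewrite eq_le ff0.
have fin := integrable_fin_num measurableT (L2_mul Lf Lf).
have e0 : (\int[mu]_x (f x * f x)%:E = 0)%E by rewrite -(fineK fin) -[RHS]/(0%:E) -ff0 ip.unlock.
have /ae_eq_integral_abs : measurable_fun setT (fun x => (f x * f x)%:E).
  by apply/measurable_EFinP; apply: measurable_funM; case: Lf.
move=> /(_ mu measurableT)[h _]; apply: filterS (h _).
  by move=> x /(_ I) [] /eqP; rewrite mulf_eq0 orbb => /eqP ? _.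
rewrite -[RHS]e0; apply: eq_integral => x _ /=.
by rewrite ger0_norm// -expr2 sqr_ge0.
Qed.

Lemma L2_bmul f g : bddm f -> L2fun mu g -> L2fun mu (fun x => f x * g x).
Proof.
move=> [mf [M fM]] [mg Ig]; split; first exact: measurable_funM.
apply: (le_integrableR _ _ (integrable_comb (M ^+ 2) 0 Ig Ig)).
  by apply: measurable_funX; exact: measurable_funM.
move=> x /=; rewrite mul0r addr0 ger0_norm ?sqr_ge0// exprMn ler_wpM2r ?sqr_ge0//.
by rewrite -real_normK ?num_real// lerXn2r// nnegrE (le_trans _ (fM x)).
Qed.

Lemma L2_le f g : measurable_fun setT f -> (forall x, `|f x| <= `|g x|) ->
  L2fun mu g -> L2fun mu f.
Proof.
move=> mf fg [mg Ig]; split => //; apply: (le_integrableR _ _ Ig).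
  exact: measurable_funX.
move=> x; rewrite ger0_norm ?sqr_ge0// -real_normK ?num_real// -[leRHS]real_normK ?num_real//.
by rewrite lerXn2r.
Qed.

Lemma bddm_cst (c : R) : bddm (fun=> c).
Proof. by split => //; exists `|c|. Qed.

Lemma bddm_lin a f g : bddm f -> bddm g -> bddm (fun x => a * f x + g x).
Proof.
move=> [mf [M fM]] [mg [N gN]]; split.
  by apply: measurable_funD => //; exact: measurable_funM.
exists (`|a| * M + N) => x; rewrite (le_trans (ler_normD _ _))// lerD// normrM.
by rewrite ler_wpM2l.
Qed.

Lemma bddm_mul f g : bddm f -> bddm g -> bddm (fun x => f x * g x).
Proof.
move=> [mf [M fM]] [mg [N gN]]; split; first exact: measurable_funM.
by exists (M * N) => x; rewrite normrM ler_pM.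
Qed.

Lemma bddL2_0 : bddL2 (fun=> 0).
Proof. by split; [exact: L2_0|exists 0 => x; rewrite normr0]. Qed.

Lemma bddL2_lin a f g : bddL2 f -> bddL2 g -> bddL2 (fun x => a * f x + g x).
Proof.
move=> bf bg; split; first by apply: L2_lin; [case: bf|case: bg].
by apply: (bddm_lin _ _ _).2; exact: bddL2_bddm.
Qed.

Lemma bddL2_bmul f g : bddm f -> bddL2 g -> bddL2 (fun x => f x * g x).
Proof.
move=> bf bg; split; first by apply: L2_bmul => //; case: bg.
by apply: (bddm_mul _ _).2 => //; exact: bddL2_bddm.
Qed.

Lemma bddL2_mul f g : bddL2 f -> bddL2 g -> bddL2 (fun x => f x * g x).
Proof. by move=> bf; apply: bddL2_bmul; exact: bddL2_bddm. Qed.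

Lemma bddL2_le f g : measurable_fun setT f -> (forall x, `|f x| <= `|g x|) ->
  bddL2 g -> bddL2 f.
Proof.
move=> mf fg [Lg [M gM]]; split; first exact: (L2_le _ fg).
by exists M => x; rewrite (le_trans (fg x)).
Qed.

Lemma nc_continuous (F : R -> R) : normal_contraction F -> continuous F.
Proof.
move=> [_ F1] x; apply/cvgrPdist_lt => e e0; near=> y.
by rewrite (le_lt_trans (F1 _ _))//; near: y; exact: cvgr_dist_lt.
Unshelve. all: end_near. Qed.

Lemma nc_norm (F : R -> R) x : normal_contraction F -> `|F x| <= `|x|.
Proof. by move=> [F0 /(_ x 0)]; rewrite F0 !subr0. Qed.

Lemma nc_measurable (F : R -> R) f : normal_contraction F -> measurable_fun setT f ->
  measurable_fun setT (fun x => F (f x)).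
Proof.
move=> /nc_continuous cF mf; apply: measurableT_comp => //.
exact: continuous_measurable_fun.
Qed.

Lemma nc_bddL2 (F : R -> R) f : normal_contraction F -> bddL2 f -> bddL2 (fun x => F (f x)).
Proof.
move=> nF bf; apply: (bddL2_le _ _ bf); first by apply: nc_measurable => //; case: bf => -[].
by move=> x; exact: nc_norm.
Qed.

(** For w >= 0 these functions increase to the indicator of {w > 0}, and being at most n w they
    inherit square integrability from w. They stand in for the constant 1, which need not lie in
    L2. *)
Definition cut (w : T -> R) (n : nat) (x : T) : R := Num.min (n%:R * w x) 1.

Lemma cut01 w n x : (forall y, 0 <= w y) -> 0 <= cut w n x <= 1.
Proof. by move=> w0; rewrite /cut le_min ler01 mulr_ge0//= ge_min lexx orbT. Qed.

Lemma bddL2_cut w n : (forall y, 0 <= w y) -> bddL2 w -> bddL2 (cut w n).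
Proof.
move=> w0 bw; apply: (bddL2_le (g := fun x => n%:R * w x + 0)).
- apply: measurable_minr => //; apply: measurable_funM => //.
  by case: bw => -[].
- move=> x; rewrite addr0 !ger0_norm ?mulr_ge0//; last by case/andP: (cut01 n x w0).
  by rewrite /cut ge_min lexx.
- by apply: bddL2_lin => //; exact: bddL2_0.
Qed.

(** Dominated convergence with bound |g q|: the cutoff is eventually 1 where w > 0, and g vanishes
    elsewhere. *)
Lemma cut_cvg w g q : (forall y, 0 <= w y) -> bddL2 w -> L2fun mu g -> L2fun mu q ->
  (forall x, w x = 0 -> g x = 0) ->
  ip (fun x => cut w n x * g x) q @[n --> \oo] --> ip g q.
Proof.
move=> w0 bw Lg Lq wg.
have mg : measurable_fun setT g by case: Lg.
have mq : measurable_fun setT q by case: Lq.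
have mc n : measurable_fun setT (cut w n) by case: (bddL2_cut n w0 bw) => -[].
have mcgq n : measurable_fun setT (fun x => (cut w n x * g x * q x)%:E).
  by apply/measurable_EFinP; do 2 apply: measurable_funM => //.
have mgq : measurable_fun setT (fun x => (g x * q x)%:E).
  by apply/measurable_EFinP; exact: measurable_funM.
have h := @dominated_convergence _ _ _ mu setT measurableT
  (fun n x => (cut w n x * g x * q x)%:E) (fun x => (g x * q x)%:E)
  (fun x => (`|g x * q x|)%:E) mcgq mgq.
have If := integrable_fin_num measurableT (L2_mul Lg Lq).
rewrite ip.unlock /Rintegral; apply: fine_cvg; rewrite fineK//.
case: h => //.
- apply: aeW => x _; apply: cvg_EFin; first exact: nearW.
  have [wx0|wx0] := eqVneq (w x) 0.
    rewrite wg// mul0r; apply: cvg_near_cst; by apply: nearW => n /=; rewrite mulr0 mul0r.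
  have {}wx0 : 0 < w x by rewrite lt0r wx0 w0.
  apply: cvg_near_cst; near=> n; rewrite /=.
  rewrite /cut min_r ?mul1r// -ler_pdivrMr// div1r.
  near: n; exact: nbhs_infty_ger.
- have := integrable_norm (L2_mul Lg Lq).
  by congr (_.-integrable _ _).
- apply: aeW => x n _; rewrite lee_fin -mulrA normrM ler_piMl//.
  by have /andP[c0 c1] := cut01 n x w0; rewrite ger0_norm.
Unshelve. all: by end_near. Qed.

End L2.

(** * Riesz representation for a complete, possibly degenerate form *)

Section Riesz.
Context {R : realType} {T : Type} (D : set (T -> R)).
Context (E : (T -> R) -> (T -> R) -> R) (l : (T -> R) -> R) (C : R).
Hypothesis D0 : D (fun=> 0).
Hypothesis Dlin : forall (a : R) f g, D f -> D g -> D (fun x => a * f x + g x).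
Hypothesis HE : is_bilinear_form D E.
Hypothesis Ecomplete : forall u : nat -> T -> R, (forall n, D (u n)) ->
  (forall e : R, 0 < e -> exists N, forall n m, (N <= n)%N -> (N <= m)%N ->
     E (fun x => u n x - u m x) (fun x => u n x - u m x) < e) ->
  exists v, D v /\ forall e : R, 0 < e -> exists N, forall n, (N <= n)%N ->
     E (fun x => u n x - v x) (fun x => u n x - v x) < e.
Hypothesis llin : forall (a : R) f g, D f -> D g ->
  l (fun x => a * f x + g x) = a * l f + l g.
Hypothesis C0 : 0 <= C.
Hypothesis lbdd : forall f, D f -> l f ^+ 2 <= C * E f f.

Let l_comb a b f g : D f -> D g ->
  l (fun x => a * f x + b * g x) = a * l f + b * l g.
Proof.
move=> Df Dg; rewrite llin//; last exact: (form_scaleP D0 Dlin b Dg).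
have l0 : l (fun=> 0) = 0.
  have := llin 1 D0 D0; rewrite (_ : (fun x => _) = (fun=> 0)); last by fring.
  lra.
rewrite (_ : (fun x => b * g x) = (fun x => b * g x + 0)); last by fring.
by rewrite llin// l0 addr0.
Qed.

Let J v := E v v - 2 * l v.

Let J_comb t v w : D v -> D w ->
  J (fun x => 1 * v x + t * w x) = J v + 2 * t * (E v w - l w) + t ^+ 2 * E w w.
Proof.
by move=> Dv Dw; rewrite /J (form_sq D0 Dlin HE)// l_comb//; ring.
Qed.

(** Since (l v)^2 <= C E(v, v), the inequality of means gives 2 l v <= E(v, v) + C. *)
Let J_ge v : D v -> - C <= J v.
Proof.
move=> Dv; have := lbdd Dv; have := form_ge0 HE Dv; rewrite /J.
move: (E v v) (l v) => e y e0 h; rewrite leNgt; apply/negP => hlt.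
have C_ge0 := C0.
have h1 : 0 < 2 * y - (e + C) by lra.
have h2 : 0 < 2 * y + (e + C) by lra.
have := mulr_gt0 h1 h2.
have := sqr_ge0 (e - C); nra.
Qed.

(** A minimising sequence of [J] is Cauchy by the parallelogram identity, and its limit satisfies
    the Euler-Lagrange equation of [J]. *)
Lemma form_Riesz : exists v, D v /\ forall w, D w -> E v w = l w.
Proof.
pose m := inf [set J v | v in D].
have hm : has_inf [set J v | v in D].
  split; first by exists (J (fun=> 0)), (fun=> 0).
  by exists (- C) => _ [v Dv <-]; exact: J_ge.
have mJ v : D v -> m <= J v by move=> Dv; apply: (inf_lbound hm.2); exists v.
have /choice[u uP] : forall n : nat, exists v, D v /\ J v < m + n.+1%:R^-1.
  move=> n; have n0 : (0 : R) < n.+1%:R^-1 by rewrite invr_gt0 ltr0n.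
  by have [_ [v Dv <-] h] := inf_adherent n0 hm; exists v.
have Du n : D (u n) by case: (uP n).
have Ju n : J (u n) < m + n.+1%:R^-1 by case: (uP n).
have small (e : R) : 0 < e -> exists N, forall n, (N <= n)%N -> n.+1%:R^-1 < e.
  move=> e0; have [N] := near_infty_natSinv_lt (PosNum e0).
  by move=> _ hN; exists N => n /hN.
have [|v [Dv vP]] := Ecomplete Du.
  move=> e e0; have [|N hN] := small (e / 4); first lra.
  exists N => n k /hN hn /hN hk.
  (* [J] is at least [m] at the midpoint of [u n] and [u k], so E(u_n - u_k) is at most twice the
     sum of the excesses of [J (u n)] and [J (u k)] over [m], hence below e. *)
  have := mJ _ (form_comb D0 Dlin (2^-1) (2^-1) (Du n) (Du k)).
  rewrite /J (form_sq D0 Dlin HE)// l_comb// (form_sqB D0 Dlin HE)//.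
  have := Ju n; have := Ju k; rewrite /J.
  move: (E (u n) (u n)) (E (u k) (u k)) (E (u n) (u k)) (l (u n)) (l (u k)) => a b c x y.
  move: (n.+1%:R^-1) (k.+1%:R^-1) hn hk => s t hn hk h1 h2 h3. lra.
exists v; split => // w Dw; apply/eqP; rewrite -subr_eq0 -sqrf_eq0 eq_le sqr_ge0 andbT.
have Ew0 := form_ge0 HE Dw.
apply/ler_addgt0Pl => e e0; rewrite addr0.
(* The square to be bounded is at most 2 B^2 + 2 E(u_n - v, w)^2, and each of the two squares is at
   most (E(w, w) + 1) e', which makes e in total. *)
pose e' := e / (4 * (E w w + 1)).
have e'0 : 0 < e' by rewrite divr_gt0//; lra.
have [N1 h1] := small _ e'0; have [N2 h2] := vP _ e'0.
pose n := maxn N1 N2; have {}h1 := h1 n (leq_maxl _ _); have {}h2 := h2 n (leq_maxr _ _).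
move: (Ju n) h1; move: (n.+1%:R^-1) => s Jun h1; pose B := E (u n) w - l w.
have hB t : 0 <= s + 2 * t * B + t ^+ 2 * E w w.
  have := mJ _ (form_comb D0 Dlin 1 t (Du n) Dw); rewrite J_comb//.
  by rewrite -/B; lra.
have B2 : B ^+ 2 <= (E w w + 1) * e'.
  (* This t nearly minimises the quadratic in [hB]; the added 1 keeps the denominator positive when
     E(w, w) = 0. *)
  have := hB (- B / (E w w + 1)); set A := E w w + 1.
  have A0 : 0 < A by rewrite /A; lra.
  rewrite -(ler_pM2l A0) mulr0 => h.
  have : A * (s + 2 * (- B / A) * B + (- B / A) ^+ 2 * E w w) =
     A * s - 2 * B ^+ 2 + B ^+ 2 * (E w w / A) by field; rewrite gt_eqF.
  have : E w w / A <= 1 by rewrite ler_pdivrMr// /A; lra.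
  have := sqr_ge0 B; nra.
have CS := form_CauchySchwarz D0 Dlin HE (form_subP Dlin (Du n) Dv) Dw.
rewrite (formBl D0 Dlin HE)// in CS.
set X := E v w - l w.
have : X ^+ 2 <= 2 * B ^+ 2 + 2 * (E (u n) w - E v w) ^+ 2.
  have := sqr_ge0 (B + (E (u n) w - E v w)); rewrite /X /B; nra.
have : (E w w + 1) * e' = e / 4 by rewrite /e'; field; rewrite gt_eqF//; lra.
have : E (fun x => u n x - v x) (fun x => u n x - v x) * E w w <= e' * E w w.
  by rewrite ler_wpM2r// ltW.
nra.
Qed.

End Riesz.

(** * The resolvent operators: symmetry, minimality and the sub-Markov property *)

(** The condition on v is the Euler-Lagrange equation of the minimisation of E(v) + b |v - g|^2. The
    default value of [xget] is excluded by [resolvent_exists] as soon as b > 0 and g is in L2. *)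
HB.lock Definition res {R : realType} {d : measure_display} {T : measurableType d}
  (mu : {measure set T -> \bar R}) (F : set (T -> R)) (E : (T -> R) -> (T -> R) -> R)
  (b : R) (g : T -> R) : T -> R :=
  xget (fun=> 0) [set v | F v /\ forall w, F w -> E v w = b * ip mu (fun x => g x - v x) w].

Section Resolvent.
Context {R : realType} {d : measure_display} {T : measurableType d}.
Context (mu : {measure set T -> \bar R}) (F : set (T -> R)).
Context (E : (T -> R) -> (T -> R) -> R).
Hypothesis HD : is_dirichlet_form mu F E.
Implicit Types (f g h v w : T -> R) (b c : R).
Local Notation ip := (ip mu).
Local Notation L2 := (L2fun mu).

Lemma dirichlet_L2 f : F f -> L2 f.
Proof. by case: HD => -[+ _ _ _ _] _; apply. Qed.

Lemma dirichlet_ae f g : F f -> measurable_fun setT g -> ae_eq mu setT f g -> F g.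
Proof. by case: HD => -[_ + _ _ _] _; apply. Qed.

Lemma dirichlet_0 : F (fun=> 0).
Proof. by case: HD => -[_ _ + _ _] _. Qed.

Lemma dirichlet_lin a f g : F f -> F g -> F (fun x => a * f x + g x).
Proof. by case: HD => -[_ _ _ + _] _; apply. Qed.

Lemma dirichlet_eq_ae f f' g : F f -> F f' -> F g -> ae_eq mu setT f f' -> E f g = E f' g.
Proof. by case: HD => -[_ _ _ _ +] _; apply. Qed.

Lemma dirichlet_form_on : is_bilinear_form F E.
Proof. by case: HD => _ []. Qed.

Lemma dirichlet_T1 f : F f -> F (fun x => T1 (f x)) /\
  E (fun x => T1 (f x)) (fun x => T1 (f x)) <= E f f.
Proof. by case: HD => _ [_ _ _]; apply. Qed.

Lemma dirichlet_eq_ae2 f f' : F f -> F f' -> ae_eq mu setT f f' -> E f f = E f' f'.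
Proof.
move=> Ff Ff' ff'; rewrite (dirichlet_eq_ae Ff Ff' Ff ff').
by rewrite (formC dirichlet_form_on Ff' Ff) (dirichlet_eq_ae Ff Ff' Ff' ff').
Qed.

Let F0 := dirichlet_0.
Let Flin := dirichlet_lin.
Let FE := dirichlet_form_on.
Let L20 := L2_0 mu.
Let L2lin := @L2_lin _ _ _ mu.
Let ipE := ip_is_form mu.
Let FL2 := dirichlet_L2.

Definition E1 b f g := E f g + b * ip f g.

Lemma E1_is_form b : 0 <= b -> is_bilinear_form F (E1 b).
Proof.
move=> b0; case: FE => EC El E0; case: ipE => iC il i0; split.
- by move=> f g Ff Fg; rewrite /E1 EC// iC//; exact: FL2.
- move=> a f f' g Ff Ff' Fg; rewrite /E1 El// il//; [ring|exact: FL2..].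
- by move=> f Ff; rewrite /E1 addr_ge0 ?E0// mulr_ge0// i0//; exact: FL2.
Qed.

(** For b > 0 the quadratic forms E + b |.|^2 and E + |.|^2 dominate each other, with factors 1 +
    b^-1 and 1 + b, so closedness of E carries over. *)
Lemma E1_complete b (u : nat -> T -> R) : 0 < b -> (forall n, F (u n)) ->
  (forall e : R, 0 < e -> exists N, forall n m, (N <= n)%N -> (N <= m)%N ->
     E1 b (fun x => u n x - u m x) (fun x => u n x - u m x) < e) ->
  exists v, F v /\ forall e : R, 0 < e -> exists N, forall n, (N <= n)%N ->
     E1 b (fun x => u n x - v x) (fun x => u n x - v x) < e.
Proof.
move=> b0 Fu uC; have b10 : 0 < 1 + b^-1 by rewrite addr_gt0// invr_gt0.
case: HD => _ [_ _ /(_ u Fu) + _] => -[|v [Fv vP]].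
  move=> e e0; have [|N hN] := uC (e / (1 + b^-1)); first by rewrite divr_gt0.
  exists N => n m Nn Nm; have := hN n m Nn Nm.
  rewrite ltr_pdivlMr//; apply: le_lt_trans; rewrite /E1 l2norm2E.
  have Fnm := form_subP Flin (Fu n) (Fu m).
  have := form_ge0 FE Fnm; have := form_ge0 ipE (FL2 Fnm).
  set i := ip _ _; set e' := E _ _ => i0 e'0.
  have -> : (e' + b * i) * (1 + b^-1) = e' + i + (b * i + e' / b) by field; rewrite gt_eqF.
  by rewrite lerDl addr_ge0// ?divr_ge0 ?mulr_ge0// ltW.
exists v; split => // e e0; have [|N hN] := vP (e / (1 + b)); first by rewrite divr_gt0// addr_gt0.
exists N => n Nn; have := hN n Nn.
rewrite ltr_pdivlMr ?addr_gt0//; apply: le_lt_trans; rewrite /E1 l2norm2E.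
have Fnm := form_subP Flin (Fu n) Fv.
have := form_ge0 FE Fnm; have := form_ge0 ipE (FL2 Fnm).
set i := ip _ _; set e' := E _ _ => i0 e'0.
have -> : (e' + i) * (1 + b) = e' + b * i + (i + b * e') by ring.
by rewrite lerDl addr_ge0// mulr_ge0// ltW.
Qed.

(** Riesz representation of w -> b <g, w> with respect to [E1 b]. Since b^2 <g, w>^2 <= b <g, g> b
    <w, w>, the constant b <g, g> bounds the functional. *)
Lemma resolvent_exists b g : 0 < b -> L2 g ->
  exists v, F v /\ forall w, F w -> E v w = b * ip (fun x => g x - v x) w.
Proof.
move=> b0 Lg.
have [||||v [Fv vP]] := @form_Riesz _ _ F (E1 b) (fun w => b * ip g w) (b * ip g g)
  F0 Flin (E1_is_form (ltW b0)).
- by move=> u; exact: E1_complete.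
- move=> a f h Ff Fh.
  rewrite (formDr L20 L2lin ipE (form_scaleP L20 L2lin a (FL2 Ff)) (FL2 Fh) Lg).
  by rewrite (formZr L20 L2lin ipE a Lg (FL2 Ff)); ring.
- by rewrite mulr_ge0 ?(ltW b0)//; exact: (form_ge0 ipE Lg).
- move=> f Ff; have := form_CauchySchwarz L20 L2lin ipE Lg (FL2 Ff).
  have := form_ge0 FE Ff; have := form_ge0 ipE Lg; rewrite /E1.
  move: (ip g f) (ip g g) (ip f f) (E f f) => x y z t y0 t0 h.
  have : 0 <= b * y * t by rewrite !mulr_ge0// ltW.
  have : 0 <= b ^+ 2 * (y * z - x ^+ 2) by rewrite mulr_ge0 ?sqr_ge0// subr_ge0.
  nra.
exists v; split => // w Fw; rewrite (formBl L20 L2lin ipE Lg (FL2 Fv) (FL2 Fw)).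
by have := vP w Fw; rewrite /E1; lra.
Qed.

Section fixed_b.
Variable b : R.
Hypothesis b0 : 0 < b.
Local Notation S := (res mu F E b).

Let resP g : L2 g -> F (S g) /\ forall w, F w -> E (S g) w = b * ip (fun x => g x - S g x) w.
Proof.
move=> Lg; have [v vP] := resolvent_exists b0 Lg; rewrite res.unlock.
case: xgetP => [w _ //|/(_ v)]; exact.
Qed.

Lemma resF g : L2 g -> F (S g). Proof. by move=> /resP[]. Qed.

Lemma resL2 g : L2 g -> L2 (S g). Proof. by move=> /resF; exact: FL2. Qed.

Lemma resE g w : L2 g -> F w -> E (S g) w = b * (ip g w - ip (S g) w).
Proof.
move=> Lg Fw; rewrite (resP Lg).2// (formBl L20 L2lin ipE)//; last exact: FL2.
exact: resL2.
Qed.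

(** The difference of two solutions has [E1 b] value 0, and b > 0 then makes its L2 norm vanish. *)
Lemma res_uniq g v : L2 g -> F v -> (forall w, F w -> E v w = b * (ip g w - ip v w)) ->
  ae_eq mu setT v (S g).
Proof.
move=> Lg Fv vP; have Fd := form_subP Flin Fv (resF Lg).
have : E1 b (fun x => v x - S g x) (fun x => v x - S g x) <= 0.
  rewrite /E1 (formBl F0 Flin FE Fv (resF Lg) Fd) vP// resE//.
  by rewrite (formBl L20 L2lin ipE (FL2 Fv) (resL2 Lg) (FL2 Fd)); lra.
rewrite /E1 => h; have Ed := form_ge0 FE Fd.
have : ip (fun x => v x - S g x) (fun x => v x - S g x) <= 0.
  by rewrite -(pmulr_rle0 _ b0); lra.
move/(ip_eq0 (FL2 Fd)); apply: filterS => x /(_ I) h' _.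
by apply/eqP; rewrite -subr_eq0 h'.
Qed.

(** [res] selects one representative for each argument, so linearity is available only off a null
    set, through [res_uniq]. *)
Lemma res_comb a c f g : L2 f -> L2 g ->
  {ae mu, forall x, S (fun y => a * f y + c * g y) x = a * S f x + c * S g x}.
Proof.
move=> Lf Lg; have := res_uniq (form_comb L20 L2lin a c Lf Lg)
  (form_comb F0 Flin a c (resF Lf) (resF Lg)).
have h w : F w -> E (fun x => a * S f x + c * S g x) w =
  b * (ip (fun y => a * f y + c * g y) w - ip (fun x => a * S f x + c * S g x) w).
  move=> Fw; have Lw := FL2 Fw.
  rewrite (form_combl F0 Flin FE a c (resF Lf) (resF Lg) Fw) !resE//.
  rewrite (form_combl L20 L2lin ipE a c (resL2 Lf) (resL2 Lg) Lw).
  rewrite (form_combl L20 L2lin ipE a c Lf Lg Lw).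
  by move: (ip f w) (ip g w) (ip (S f) w) (ip (S g) w) => *; ring.
by move=> /(_ h); apply: filterS => x /(_ I) ->.
Qed.

Lemma res0 : {ae mu, forall x, S (fun=> 0) x = 0}.
Proof.
have h : S (fun=> 0) = S (fun y => 0 * (fun=> 0) y + 0 * (fun=> 0) y).
  by congr S; fring.
by rewrite h; apply: filterS (res_comb 0 0 L20 L20) => x ->; ring.
Qed.

(** Compute E(S f, S g) by the equation of S f and by that of S g; the common term <S f, S g>
    cancels. *)
Lemma res_sym f g : L2 f -> L2 g -> ip (S f) g = ip f (S g).
Proof.
move=> Lf Lg; have := resE Lf (resF Lg); have := resE Lg (resF Lf).
rewrite (formC FE (resF Lf) (resF Lg)) => ->.
move=> /(mulfI (lt0r_neq0 b0)).
rewrite (formC ipE (resL2 Lg) (resL2 Lf)) => /addIr.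
by rewrite (formC ipE Lg (resL2 Lf)).
Qed.

(** Completing the square: the excess of the minimised functional at w over its minimum is exactly
    [E1 b] at w - S g. *)
Lemma res_min g w : L2 g -> F w ->
  E w w + b * ip (fun x => w x - g x) (fun x => w x - g x) =
  E (S g) (S g) + b * ip (fun x => S g x - g x) (fun x => S g x - g x)
  + E1 b (fun x => w x - S g x) (fun x => w x - S g x).
Proof.
move=> Lg Fw; have Lw := FL2 Fw; have FS := resF Lg; have LS := resL2 Lg.
rewrite /E1 !(form_sqB L20 L2lin ipE)// (form_sqB F0 Flin FE Fw FS).
rewrite (formC FE Fw FS) !resE// (formC ipE Lw Lg) (formC ipE LS Lg) (formC ipE Lw LS).
ring.
Qed.

(** The minimum of the functional is a^b(g, g). *)
Lemma res_energy g : L2 g ->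
  E (S g) (S g) + b * ip (fun x => S g x - g x) (fun x => S g x - g x) =
  b * (ip g g - ip (S g) g).
Proof.
move=> Lg; have LS := resL2 Lg; rewrite (form_sqB L20 L2lin ipE)// resE//; last exact: resF.
by rewrite (formC ipE LS Lg); ring.
Qed.

(** Replacing S g by T_1(S g) does not increase E, nor the distance to g because g has values in
    [0, 1]. So T_1(S g) is also a minimiser, and by [res_min] it equals S g almost everywhere. *)
Lemma res01 g : L2 g -> (forall x, 0 <= g x <= 1) -> {ae mu, forall x, 0 <= S g x <= 1}.
Proof.
move=> Lg g01; have FS := resF Lg; have [FT ET] := dirichlet_T1 FS.
have := res_min Lg FT; set v := fun x => T1 (S g x).
have Fd := form_subP Flin FT FS.
have LT := form_subP L2lin (FL2 FT) Lg; have LS := form_subP L2lin (resL2 Lg) Lg.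
have : ip (fun x => v x - g x) (fun x => v x - g x) <=
       ip (fun x => S g x - g x) (fun x => S g x - g x).
  apply: ip_mono => //; apply: aeW => x; rewrite /v /T1.
  have /andP[g0 g1] := g01 x.
  have [s0|s0] := leP (S g x) 0.
    by rewrite min_l ?ler01//; nra.
  by have [s1|s1] := leP (S g x) 1; nra.
rewrite -(ler_pM2l b0) => h1 h2.
have : ip (fun x => v x - S g x) (fun x => v x - S g x) <= 0.
  rewrite -(pmulr_rle0 _ b0).
  have := form_ge0 FE Fd; rewrite /E1 -/v in h2 ET *; lra.
move/(ip_eq0 (FL2 Fd)); apply: filterS => x /(_ I) /eqP; rewrite subr_eq0 => /eqP <-.
by rewrite /v /T1 le_min ler01 le_max lexx orbT/= ge_min lexx orbT.
Qed.

(** Scaling [res01] settles functions with values in [0, c]. In general write g as its positive part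
    minus its negative part: S of the first is at most c, and S of the second is nonnegative. *)
Lemma res_le c g : bddL2 mu g -> 0 <= c -> (forall x, g x <= c) ->
  {ae mu, forall x, S g x <= c}.
Proof.
have pos k c' : L2 k -> 0 <= c' -> (forall x, 0 <= k x <= c') ->
    {ae mu, forall x, 0 <= S k x <= c'}.
  move=> Lk c0 kc; have [c'0|c'0] := eqVneq c' 0.
    have -> : k = fun=> 0 by apply/funext => x; have := kc x; rewrite c'0; lra.
    by apply: filterS res0 => x ->; rewrite lexx.
  have {}c0 : 0 < c' by rewrite lt0r c'0.
  have Lk' := form_scaleP L20 L2lin (c'^-1) Lk.
  have k01 x : 0 <= c'^-1 * k x <= 1.
    by rewrite mulrC divr_ge0 ?ler_pdivrMr ?mul1r// ?(ltW c0)//; case/andP: (kc x).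
  have := res_comb c' 0 Lk' Lk'; have := res01 Lk' k01.
  have <- : k = fun y => c' * (c'^-1 * k y) + 0 * (c'^-1 * k y).
    by apply/funext => x; field.
  apply: filterS2 => x /andP[h0 h1] ->; rewrite mul0r addr0 mulr_ge0 ?(ltW c0)//=.
  by rewrite -[leRHS]mulr1 ler_pM2l.
move=> [Lg [M gM]] c0 gc.
have mg : measurable_fun setT g by case: Lg.
pose p x := Num.max (g x) 0; pose n x := Num.max (- g x) 0.
have Lp : L2 p.
  apply: (L2_le _ _ Lg); first exact: measurable_maxr.
  by move=> x; rewrite /p; case: (leP (g x) 0) => //; rewrite normr0.
have Ln : L2 n.
  apply: (L2_le _ _ Lg); first by apply: measurable_maxr => //; exact: measurableT_comp.
  by move=> x; rewrite /n; case: (leP (- g x) 0) => //; rewrite ?normr0// normrN.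
have gE : g = fun x => 1 * p x + (- 1) * n x.
  apply/funext => x; rewrite /p /n; have [g0|g0] := leP (g x) 0.
    by rewrite max_l; lra.
  by rewrite max_r; lra.
rewrite gE.
have hp : {ae mu, forall x, 0 <= S p x <= c}.
  by apply: pos => // x; rewrite /p le_max lexx orbT/= ge_max gc.
have hn : {ae mu, forall x, 0 <= S n x <= Num.max M 0}.
  apply: pos => //; first by rewrite le_max lexx orbT.
  move=> x; rewrite /n le_max lexx orbT/= ge_max !le_max lexx !orbT andbT.
  by rewrite (le_trans _ (gM x))// lerNl lerNnormlW.
have := res_comb 1 (-1) Lp Ln.
by apply: filterS3 hp hn => x /andP[_ h1] /andP[h2 _] ->; lra.
Qed.

Lemma res_ge c g : bddL2 mu g -> 0 <= c -> (forall x, - c <= g x) ->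
  {ae mu, forall x, - c <= S g x}.
Proof.
move=> bg c0 gc.
have bg' : bddL2 mu (fun x => (-1) * g x + 0 * g x).
  by apply: bddL2_lin => //; apply: bddL2_bmul => //; exact: bddm_cst.
have h x : (-1) * g x + 0 * g x <= c by have := gc x; lra.
have := res_comb (-1) 0 bg.1 bg.1.
by apply: filterS2 (res_le bg' c0 h) => x /[swap] ->; lra.
Qed.

End fixed_b.
End Resolvent.

(** * Convergence of the approximating forms a^b to E *)

Lemma sqr_lt_bounds {R : realType} (e x : R) : 0 < e -> x ^+ 2 < e ^+ 2 -> - e < x < e.
Proof. by move=> e0 h; apply/andP; split; nra. Qed.

Section Approximation.
Context {R : realType} {d : measure_display} {T : measurableType d}.
Context (mu : {measure set T -> \bar R}) (F : set (T -> R)).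
Context (E : (T -> R) -> (T -> R) -> R).
Hypothesis HD : is_dirichlet_form mu F E.
Implicit Types (f g h v w : T -> R) (b c : R).
Local Notation ip := (ip mu).
Local Notation L2 := (L2fun mu).
Local Notation res := (res mu F E).
Local Notation E1 := (E1 mu E).
Let F0 := dirichlet_0 HD.
Let Flin := dirichlet_lin HD.
Let FE := dirichlet_form_on HD.
Let L20 := L2_0 mu.
Let L2lin := @L2_lin _ _ _ mu.
Let ipE := ip_is_form mu.
Let FL2 := dirichlet_L2 HD.

Definition aform b f g := b * (ip f g - ip (res b f) g).

(** Test [res_min] at parameter b with the minimiser for c; raising b to c in front of the squared
    distance turns the tested value into a^c(g, g). *)
Lemma E1_le_aformB b c g : 0 < b -> b <= c -> L2 g ->
  E1 b (fun x => res c g x - res b g x) (fun x => res c g x - res b g x) <=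
  aform c g g - aform b g g.
Proof.
move=> b0 bc Lg; have c0 : 0 < c by exact: lt_le_trans bc.
have Fc := resF HD c0 Lg; have := res_min HD b0 Lg Fc.
have := res_energy HD c0 Lg; have := res_energy HD b0 Lg.
have := form_ge0 ipE (form_subP L2lin (FL2 Fc) Lg).
rewrite /aform; set i := ip _ _ => i0; have : 0 <= (c - b) * i by rewrite mulr_ge0// subr_ge0.
lra.
Qed.

(** Test the minimisation with g itself, where the distance term vanishes. *)
Lemma aform_le b g : 0 < b -> F g -> aform b g g <= E g g.
Proof.
move=> b0 Fg; have Lg := FL2 Fg; have := res_min HD b0 Lg Fg.
rewrite (res_energy HD b0 Lg) -/(aform b g g).
have := form_ge0 (E1_is_form HD (ltW b0)) (form_subP Flin Fg (resF HD b0 Lg)).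
rewrite (form_sqB L20 L2lin ipE Lg Lg); lra.
Qed.

Local Notation S n := (res n.+1%:R).

(* The values a^b(g, g) increase with b, and their increments bound the E_1-distance
   of the minimisers. *)
Lemma form_of_aform g C : L2 g -> (forall n, aform n.+1%:R g g <= C) ->
  [/\ F g, E g g <= C & forall e : R, 0 < e -> exists N, forall n, (N <= n)%N ->
    E (fun x => S n g x - g x) (fun x => S n g x - g x) < e].
Proof.
move=> Lg gC; pose m n := aform n.+1%:R g g.
have b0 n : (0 : R) < n.+1%:R by rewrite ltr0n.
have b1 n : (1 : R) <= n.+1%:R by rewrite ler1n.
have Fu n : F (S n g) by exact: resF.
have hs : has_sup (range m).
  by split; [exists (m 0%N), 0%N|exists C => _ [n _ <-]; exact: gC].
have inc n k : (n <= k)%N -> E1 1 (fun x => S k g x - S n g x) (fun x => S k g x - S n g x)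
    <= m k - m n.
  move=> nk; apply: le_trans (E1_le_aformB (b0 n) _ Lg); last by rewrite ler_nat.
  rewrite /E1 lerD2l ler_wpM2r//.
  exact: (form_ge0 ipE (FL2 (form_subP Flin (Fu k) (Fu n)))).
have E10 := form_ge0 (E1_is_form HD ler01).
have [|v [Fv vP]] := E1_complete HD (@ltr01 R) Fu.
  move=> e e0; have [_ [N _ <-] hN] := sup_adherent e0 hs.
  (* The increment m k - m n is at most sup m - m N, which is below e by the choice of N. *)
  have key n k : (N <= n)%N -> (n <= k)%N ->
      E1 1 (fun x => S k g x - S n g x) (fun x => S k g x - S n g x) < e.
    move=> Nn nk; have := inc _ _ nk; have := inc _ _ Nn.
    have := E10 _ (form_subP Flin (Fu n) (Fu N)).
    have : m k <= sup (range m) by apply: sup_upper_bound => //; exists k.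
    by lra.
  exists N => n k Nn Nk; have [nk|/ltnW kn] := leqP n k; last exact: key.
  rewrite (form_sqB F0 Flin (E1_is_form HD ler01))//.
  have := key _ _ Nn nk; rewrite (form_sqB F0 Flin (E1_is_form HD ler01))//.
  by rewrite (formC (E1_is_form HD ler01) (Fu k) (Fu n)); lra.
have Lv := FL2 Fv.
(* The distance term in the minimum is at most C, so |S_n g - g|^2 <= C / (n + 1) and S_n g tends to
   g in L2 as well as to v. Saturation of F then puts g in F. *)
have vg : ae_eq mu setT v g.
  have : ip (fun x => v x - g x) (fun x => v x - g x) <= 0.
    apply/ler_addgt0Pl => e e0; rewrite addr0.
    have [|N1 h1] := vP (e / 4); first lra.
    have C0 : 0 <= C.
      apply: le_trans (gC 0%N); rewrite /aform -(res_energy HD (b0 0%N) Lg).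
      rewrite addr_ge0 ?mulr_ge0//; first exact: (form_ge0 FE).
      exact: (form_ge0 ipE (form_subP L2lin (FL2 (Fu 0%N)) Lg)).
    have /archi_boundP : 0 <= 4 * C / e by rewrite divr_ge0 ?mulr_ge0// ltW.
    set N2 := Num.bound _ => h2; pose n := maxn N1 N2.
    have {}h1 := h1 n (leq_maxl _ _).
    have {}h2 : 4 * C < e * n.+1%:R.
      rewrite [ltRHS]mulrC -ltr_pdivrMr// (lt_le_trans h2)// ler_nat (leq_trans _ (leqnSn _))//.
      exact: leq_maxr.
    have := gC n; rewrite /aform -(res_energy HD (b0 n) Lg).
    have := form_ge0 FE (Fu n); move: h1; rewrite /E1 mul1r.
    have := form_ge0 FE (form_subP Flin (Fu n) Fv).
    have := form_le2B L20 L2lin ipE (form_subP L2lin Lv Lg) (form_subP L2lin (FL2 (Fu n)) Lg).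
    rewrite (_ : (fun x => v x - g x - (S n g x - g x)) = (fun x => v x - S n g x)); last by fring.
    rewrite (form_subC L20 L2lin ipE Lv (FL2 (Fu n))).
    set k := ip (fun x => S n g x - g x) _; set c := ip (fun x => S n g x - v x) _.
    move: (n.+1%:R) (b0 n) (ip _ _) (E _ _) (E _ _) k c h2 => s s0 a y z k c h2 h3 y0 h4 z0 h5.
    have : s * k < s * (e / 4) by lra.
    by rewrite ltr_pM2l//; lra.
  move/(ip_eq0 (form_subP L2lin Lv Lg)); apply: filterS => x /(_ I) /eqP.
  by rewrite subr_eq0 => /eqP.
have Fg : F g := dirichlet_ae HD Fv Lg.1 vg.
have cvgE (e : R) : 0 < e -> exists N, forall n, (N <= n)%N ->
    E (fun x => S n g x - g x) (fun x => S n g x - g x) < e.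
  move=> /vP[N hN]; exists N => n /hN; apply: le_lt_trans.
  rewrite (dirichlet_eq_ae2 HD (form_subP Flin (Fu n) Fg) (form_subP Flin (Fu n) Fv)).
    by rewrite lerDl mul1r (form_ge0 ipE (FL2 (form_subP Flin (Fu n) Fv))).
  by apply: filterS vg => x vg /vg ->.
(* By Cauchy-Schwarz E(S_N g, g) is within e of E(g, g) for a suitable N, and E(S_N g, g) =
   [aform N.+1%:R g g] <= C. *)
split => //; apply/ler_addgt0Pl => e e0.
have Eg0 := form_ge0 FE Fg.
have [|N hN] := cvgE (e ^+ 2 / (E g g + 1)); first by rewrite divr_gt0 ?exprn_gt0//; lra.
have {}hN := hN N (leqnn N).
have := form_CauchySchwarz F0 Flin FE (form_subP Flin (Fu N) Fg) Fg.
have := gC N; rewrite /aform -(resE HD (b0 N) Lg Fg) (formBl F0 Flin FE (Fu N) Fg Fg).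
move: hN; rewrite ltr_pdivlMr; last by lra.
have := form_ge0 FE (form_subP Flin (Fu N) Fg).
move: (E (fun _ => _) _) (E (S N g) g) (E g g) Eg0 => a y c c0 a0 h1 h2 h3.
have : (y - c) ^+ 2 < e ^+ 2 by nra.
by move=> /(sqr_lt_bounds e0); lra.
Qed.

(** The equation of the resolvent reads a^b(f, g) = E(S f, g), and E(S f - f) -> 0, so
    Cauchy-Schwarz concludes. *)
Lemma aform_cvg f g : F f -> F g -> aform n.+1%:R f g @[n --> \oo] --> E f g.
Proof.
move=> Ff Fg; have Lf := FL2 Ff.
have b0 n : (0 : R) < n.+1%:R by rewrite ltr0n.
have [|_ _ cE] := @form_of_aform f (E f f) Lf; first by move=> n; exact: aform_le.
have Eg0 := form_ge0 FE Fg.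
apply/cvgrPdist_lt => e e0.
have [|N hN] := cE (e ^+ 2 / (E g g + 1)); first by rewrite divr_gt0 ?exprn_gt0//; lra.
exists N => // n /hN {}hN.
have := form_CauchySchwarz F0 Flin FE (form_subP Flin (resF HD (b0 n) Lf) Ff) Fg.
rewrite /aform -(resE HD (b0 n) Lf Fg) (formBl F0 Flin FE (resF HD (b0 n) Lf) Ff Fg).
have := form_ge0 FE (form_subP Flin (resF HD (b0 n) Lf) Ff).
move: hN; rewrite ltr_pdivlMr; last by lra.
move: (E (fun _ => _) _) (E (S n f) g) (E f g) (E g g) Eg0 => a y z c c0 a0 h1 h3.
have : (z - y) ^+ 2 < e ^+ 2 by nra.
by move=> /(sqr_lt_bounds e0) h; rewrite ltr_norml.
Qed.

End Approximation.

(** * Almost everywhere inequalities obtained by applying S to pointwise ones *)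

Section Pointwise.
Context {R : realType} {d : measure_display} {T : measurableType d}.
Context (mu : {measure set T -> \bar R}) (F : set (T -> R)).
Context (E : (T -> R) -> (T -> R) -> R).
Hypothesis HD : is_dirichlet_form mu F E.
Implicit Types (f g h u v w : T -> R) (c : R).
Local Notation L2 := (L2fun mu).
Local Notation bddL2 := (bddL2 mu).
Variable b : R.
Hypothesis b0 : 0 < b.
Local Notation S := (res mu F E b).

Lemma continuous_ge0_rat (k : R -> R) : continuous k -> (forall q : rat, 0 <= k (ratr q)) ->
  forall r, 0 <= k r.
Proof.
move=> ck kq r; rewrite leNgt; apply/negP => kr.
have op : open (k @^-1` [set y | y < 0]).
  by apply: open_comp; [move=> x _; exact: ck|exact: open_lt].
have [x [/= kx [q _ qx]]] := dense_rat (ex_intro _ r kr) op.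
by move: kx; rewrite -qx ltNge kq.
Qed.

(** Separate continuity suffices because [res_pointwise] passes from rational to real parameters one
    variable at a time. *)
Definition sep_continuous (c : R -> R -> R) :=
  (forall t, continuous (c ^~ t)) /\ (forall r, continuous (c r)).

(** A list of pairs (c_i, p_i) encodes the family of functions y -> sum_i c_i(r, t) p_i(y) with real
    parameters r and t; S acts on the variable y. *)
Definition admissible (l : seq ((R -> R -> R) * (T -> R))) : Prop :=
  foldr (fun p => and (sep_continuous p.1 /\ bddL2 p.2)) True l.

Lemma bddL2_sum l r t : admissible l -> bddL2 (fun x => \sum_(p <- l) p.1 r t * p.2 x).
Proof.
elim: l => [|p l IH] /=.
  move=> _; rewrite (_ : (fun x => _) = fun=> 0); first exact: bddL2_0.
  by apply/funext => x; rewrite big_nil.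
move=> [[_ bp] /IH bl]; under eq_fun do rewrite big_cons.
exact: bddL2_lin.
Qed.

Lemma res_sum l r t : admissible l ->
  {ae mu, forall x, S (fun x => \sum_(p <- l) p.1 r t * p.2 x) x =
                    \sum_(p <- l) p.1 r t * S p.2 x}.
Proof.
elim: l => [|p l IH] /=.
  move=> _; rewrite (_ : (fun x => \sum_(p <- [::]) _) = fun=> 0).
    by apply: filterS (res0 HD b0) => x ->; rewrite big_nil.
  by apply/funext => x; rewrite big_nil.
move=> [[_ bp] al].
rewrite (_ : (fun x => \sum_(p0 <- p :: l) _) =
    fun x => p.1 r t * p.2 x + 1 * \sum_(p <- l) p.1 r t * p.2 x); last first.
  by apply/funext => x; rewrite big_cons mul1r.
have := res_comb HD b0 (p.1 r t) 1 bp.1 (bddL2_sum r t al).1.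
by apply: filterS2 (IH al) => x e ->; rewrite big_cons e mul1r.
Qed.

Lemma sep_continuous_sum l (a : T -> (T -> R) -> R) (c0 : R -> R -> R) x : admissible l ->
  sep_continuous c0 ->
  sep_continuous (fun r t : R => \sum_(p <- l) p.1 r t * a x p.2 + c0 r t).
Proof.
move=> al cc0; elim: l al => [|p l IH] /=.
  move=> _; rewrite (_ : (fun r t : R => _) = c0)//.
  by apply/funext => r; apply/funext => t; rewrite big_nil add0r.
move=> [[[c1 c2] _] /IH[i1 i2]].
rewrite (_ : (fun r t : R => _) = (fun r t : R => p.1 r t * a x p.2 +
   (\sum_(p <- l) p.1 r t * a x p.2 + c0 r t))); last first.
  by apply/funext => r; apply/funext => t; rewrite big_cons addrA.
split=> [t|r] z; apply: cvgD; [|exact: i1| |exact: i2].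
  by apply: cvgM; [exact: c1|exact: cvg_cst].
by apply: cvgM; [exact: c2|exact: cvg_cst].
Qed.

(* S need not have a kernel, so the inequality is only integrated for countably
   many values of the parameters (r, t), which are then specialised to
   (u x, h x) by continuity. *)
Lemma res_pointwise l (c0 : R -> R -> R) u h : admissible l -> sep_continuous c0 ->
  (forall r t, 0 <= c0 r t) ->
  (forall r t x, 0 <= \sum_(p <- l) p.1 r t * p.2 x + c0 r t) ->
  {ae mu, forall x, 0 <= \sum_(p <- l) p.1 (u x) (h x) * S p.2 x + c0 (u x) (h x)}.
Proof.
move=> al cc0 c0_ge0 l_ge0.
pose P (n : nat) x := if @unpickle (rat * rat)%type n is Some (q, s) then
  0 <= \sum_(p <- l) p.1 (ratr q) (ratr s) * S p.2 x + c0 (ratr q) (ratr s) else true.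
have aeP n : {ae mu, forall x, P n x}.
  rewrite /P; case: unpickle => [[q s]|]; last exact: aeW.
  have hge x : - c0 (ratr q) (ratr s) <= \sum_(p <- l) p.1 (ratr q) (ratr s) * p.2 x.
    by have := l_ge0 (ratr q) (ratr s) x; lra.
  (* The term c0, constant in y, stays outside the list: S is only sub-Markov, so a lower bound - c0
     survives it because c0 >= 0. *)
  have := res_ge HD b0 (bddL2_sum _ _ al) (c0_ge0 (ratr q) (ratr s)) hge.
  by apply: filterS2 (res_sum (ratr q) (ratr s) al) => x ->; lra.
have : {ae mu, forall x, forall n, P n x} by exact: ae_foralln.
apply: filterS => x Px.
have [k1 k2] := sep_continuous_sum (fun x g => S g x) x al cc0.
move: (u x) => r; apply: (continuous_ge0_rat (k1 (h x))) => q /=.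
apply: (continuous_ge0_rat (k2 (ratr q))) => s.
by have := Px (pickle (q, s)); rewrite /P pickleK.
Qed.

(* If S had a kernel s(x, dy), this would be
   \int (f(y) - f(x))^2 s(x, dy) + (1 - S 1 (x)) f(x)^2. *)
Definition gam f : T -> R := fun x => S (fun y => f y * f y) x - 2 * f x * S f x + f x * f x.

Local Ltac cont := split=> ? ?; repeat first
  [exact: cvg_cst | exact: cvg_id | apply: cvgM | apply: cvgD | apply: cvgN].

Local Ltac adm := rewrite /admissible /=;
  repeat (split; [split; [cont|by do ?[assumption|apply: bddL2_mul]]|]).

(** With r = f(x), the list together with [c0] is the expansion of (r - f(y))^2 - (phi(r) -
    phi(f(y)))^2 >= 0, where [c0] collects the terms free of y. *)
Lemma gam_contraction (phi : R -> R) f : normal_contraction phi -> bddL2 f ->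
  {ae mu, forall x, gam (fun y => phi (f y)) x <= gam f x}.
Proof.
move=> nphi bf; have bpf := nc_bddL2 nphi bf.
have cphi := nc_continuous nphi.
pose l := [:: ((fun r t : R => 1), (fun y => f y * f y)); ((fun r t : R => - 2 * r), f);
  ((fun r t : R => - 1), (fun y => phi (f y) * phi (f y)));
  ((fun r t : R => 2 * phi r), (fun y => phi (f y)))].
have al : admissible l.
  split; first by split; [cont|exact: bddL2_mul].
  split; first by split; [cont|].
  split; first by split; [cont|exact: bddL2_mul].
  by split => //; split => //; split=> [t|r] z; apply: cvgM;
    [exact: cvg_cst|exact: cphi|exact: cvg_cst|exact: cvg_cst].
have sq r s : `|phi r - phi s| <= `|r - s| -> (phi r - phi s) ^+ 2 <= (r - s) ^+ 2.
  by move=> h; rewrite -real_normK ?num_real// -[leRHS]real_normK ?num_real// lerXn2r.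
have phi2 r : phi r ^+ 2 <= r ^+ 2.
  by have := sq r 0 (nphi.2 r 0); rewrite nphi.1 !subr0.
have cc0 : sep_continuous (fun r t : R => r * r - phi r * phi r).
  split=> [t|r] z; [|exact: cvg_cst].
  by apply: cvgB; apply: cvgM => //; exact: cphi.
apply: filterS (res_pointwise f f al cc0 _ _) => [x|r t|r t x].
- by rewrite /l !big_cons big_nil /gam /=; lra.
- by have := phi2 r; lra.
- by rewrite /l !big_cons big_nil /=; have := sq _ _ (nphi.2 r (f x)); lra.
Qed.

(** The zero function is a normal contraction, and [gam] vanishes almost everywhere at 0. *)
Lemma gam_ge0 f : bddL2 f -> {ae mu, forall x, 0 <= gam f x}.
Proof.
move=> bf; have n0 : normal_contraction (fun _ : R => 0 : R).
  by split=> // x y; rewrite subrr normr0.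
have := gam_contraction n0 bf; rewrite /gam mulr0.
by apply: filterS2 (res0 HD b0) => x ->; lra.
Qed.

(** With r = u(x) and t = h(x), u(y) h(y) - r t is the sum of t (u(y) - r) and u(y) (h(y) - t). Then
    use (A + B)^2 <= 2 A^2 + 2 B^2 and u(y)^2 <= U^2. *)
Lemma gam_mul_le (U : R) u h : bddL2 u -> bddL2 h -> (forall x, `|u x| <= U) ->
  {ae mu, forall x, gam (fun y => u y * h y) x <=
     2 * (h x * h x * gam u x) + 2 * U ^+ 2 * gam h x}.
Proof.
move=> bu bh uU; have buh := bddL2_mul bu bh.
have uU2 x : u x ^+ 2 <= U ^+ 2.
  by rewrite -real_normK ?num_real// lerXn2r// nnegrE (le_trans _ (uU x)).
pose l := [:: ((fun r t : R => 2 * (t * t)), (fun y => u y * u y));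
  ((fun r t : R => - 4 * (r * (t * t))), u);
  ((fun r t : R => 2 * U ^+ 2), (fun y => h y * h y)); ((fun r t : R => t * (- 4 * U ^+ 2)), h);
  ((fun r t : R => -1), (fun y => (u y * h y) * (u y * h y)));
  ((fun r t : R => 2 * (r * t)), (fun y => u y * h y))].
have al : admissible l by adm.
have cc0 : sep_continuous (fun r t : R => r * r * (t * t) + 2 * U ^+ 2 * (t * t)) by cont.
apply: filterS (res_pointwise u h al cc0 _ _) => [x|r t|r t x].
- by rewrite /l !big_cons big_nil /gam /=; lra.
- by have := sqr_ge0 (r * t); have := sqr_ge0 (U * t); lra.
- rewrite /l !big_cons big_nil /=.
  have := sqr_ge0 (t * (u x - r) - u x * (h x - t)).
  have : 0 <= (U ^+ 2 - u x ^+ 2) * (h x - t) ^+ 2 by rewrite mulr_ge0 ?sqr_ge0// subr_ge0.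
  lra.
Qed.

(** The same product identity, solved for t (u(y) - r). *)
Lemma gam_mul_ge (U : R) u h : bddL2 u -> bddL2 h -> (forall x, `|u x| <= U) ->
  {ae mu, forall x, h x * h x * gam u x <=
     2 * gam (fun y => u y * h y) x + 2 * U ^+ 2 * gam h x}.
Proof.
move=> bu bh uU; have buh := bddL2_mul bu bh.
have uU2 x : u x ^+ 2 <= U ^+ 2.
  by rewrite -real_normK ?num_real// lerXn2r// nnegrE (le_trans _ (uU x)).
pose l := [:: ((fun r t : R => - (t * t)), (fun y => u y * u y));
  ((fun r t : R => 2 * (r * (t * t))), u);
  ((fun r t : R => 2 * U ^+ 2), (fun y => h y * h y)); ((fun r t : R => t * (- 4 * U ^+ 2)), h);
  ((fun r t : R => 2), (fun y => (u y * h y) * (u y * h y)));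
  ((fun r t : R => - 4 * (r * t)), (fun y => u y * h y))].
have al : admissible l by adm.
have cc0 : sep_continuous (fun r t : R => r * r * (t * t) + 2 * U ^+ 2 * (t * t)) by cont.
apply: filterS (res_pointwise u h al cc0 _ _) => [x|r t|r t x].
- by rewrite /l !big_cons big_nil /gam /=; lra.
- by have := sqr_ge0 (r * t); have := sqr_ge0 (U * t); lra.
- rewrite /l !big_cons big_nil /=.
  have := sqr_ge0 ((u x * h x - r * t) + u x * (h x - t)).
  have : 0 <= (U ^+ 2 - u x ^+ 2) * (h x - t) ^+ 2 by rewrite mulr_ge0 ?sqr_ge0// subr_ge0.
  lra.
Qed.

(** For the increments a of f and b of g, 2 (a - b)^2 + 2 b^2 - a^2 = (a - 2 b)^2. *)
Lemma gam_sub_le f g : bddL2 f -> bddL2 g ->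
  {ae mu, forall x, gam f x <= 2 * gam (fun y => f y - g y) x + 2 * gam g x}.
Proof.
move=> bf bg; have bd := form_subP (@bddL2_lin _ _ _ mu) bf bg.
pose l := [:: ((fun r t : R => -1), (fun y => f y * f y)); ((fun r t : R => 2 * r), f);
  ((fun r t : R => 2), (fun y => (f y - g y) * (f y - g y)));
  ((fun r t : R => -4 * (r - t)), (fun y => f y - g y));
  ((fun r t : R => 2), (fun y => g y * g y)); ((fun r t : R => -4 * t), g)].
have al : admissible l by adm.
have cc0 : sep_continuous (fun r t => (r - 2 * t) * (r - 2 * t)) by cont.
apply: filterS (res_pointwise f g al cc0 _ _) => [x|r t|r t x].
- by rewrite /l !big_cons big_nil /gam /=; lra.
- by have := sqr_ge0 (r - 2 * t); lra.
- rewrite /l !big_cons big_nil /=.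
  have := sqr_ge0 ((f x - r) - 2 * (g x - t)); lra.
Qed.

(** Unlike in [gam], the weight h is taken at y: formally this is the integral of (f(y) - f(x))^2
    h(y) against s(x, dy). *)
Lemma res_square_mul f h : bddL2 f -> bddL2 h -> (forall x, 0 <= h x) ->
  {ae mu, forall x, 0 <= S (fun y => f y * f y * h y) x
    - 2 * f x * S (fun y => f y * h y) x + f x * f x * S h x}.
Proof.
move=> bf bh h0.
pose l := [:: ((fun r t : R => 1), (fun y => f y * f y * h y));
  ((fun r t : R => - 2 * r), (fun y => f y * h y)); ((fun r t : R => r * r), h)].
have al : admissible l by adm.
have cc0 : sep_continuous (fun r t : R => 0) by cont.
apply: filterS (res_pointwise f f al cc0 _ _) => [x|//|r t x].
- by rewrite /l !big_cons big_nil /=; lra.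
- rewrite /l !big_cons big_nil /=.
  have : 0 <= (f x - r) ^+ 2 * h x by rewrite mulr_ge0 ?sqr_ge0.
  lra.
Qed.

(** As S is sub-Markov, each of S(f^2), |f S f| and f^2 is at most U^2. *)
Lemma gam_le_sup (U : R) f : bddL2 f -> (forall x, `|f x| <= U) ->
  {ae mu, forall x, gam f x <= 4 * U ^+ 2}.
Proof.
move=> bf fU.
have fU2 x : - U <= f x <= U by rewrite -ler_norml.
have [U0|U0] := leP 0 U; last first.
  by apply: aeW => x; have := fU x; rewrite leNgt (lt_le_trans U0).
have h1 : {ae mu, forall x, S f x <= U}.
  by apply: (res_le HD b0) => // x; case/andP: (fU2 x).
have h2 : {ae mu, forall x, - U <= S f x}.
  by apply: (res_ge HD b0) => // x; case/andP: (fU2 x).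
have h3 : {ae mu, forall x, S (fun y => f y * f y) x <= U ^+ 2}.
  apply: (res_le HD b0); [exact: bddL2_mul|exact: sqr_ge0|move=> x].
  have /andP[] := fU2 x; nra.
apply: filterS3 h1 h2 h3 => x h1 h2 h3; rewrite /gam.
have /andP[] := fU2 x; nra.
Qed.

End Pointwise.

(** * Inequalities for a^b and its Lagrangian [lam] *)

Section Integrated.
Context {R : realType} {d : measure_display} {T : measurableType d}.
Context (mu : {measure set T -> \bar R}) (F : set (T -> R)).
Context (E : (T -> R) -> (T -> R) -> R).
Hypothesis HD : is_dirichlet_form mu F E.
Implicit Types (f g h k u v w : T -> R) (c : R).
Local Notation ip := (ip mu).
Local Notation L2 := (L2fun mu).
Local Notation bddL2 := (bddL2 mu).
Variable b : R.
Hypothesis b0 : 0 < b.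
Local Notation S := (res mu F E b).
Local Notation gam := (gam mu F E b).
Local Notation aform := (aform mu F E b).
Let L20 := L2_0 mu.
Let L2lin := @L2_lin _ _ _ mu.
Let ipE := ip_is_form mu.

Lemma gam_L2 f : bddL2 f -> L2 (gam f).
Proof.
move=> bf; have bff := bddL2_mul bf bf.
rewrite (_ : gam f = fun x => 1 * (-2 * (f x * S f x) + 1 * S (fun y => f y * f y) x) + f x * f x).
  apply: L2lin; last by case: bff.
  apply: (form_comb L20 L2lin); last by apply: (resL2 HD b0); case: bff.
  by apply: L2_bmul; [exact: (bddL2_bddm bf)|apply: (resL2 HD b0); case: bf].
by rewrite /gam; fring.
Qed.

Lemma ip_gam f k : bddL2 f -> bddL2 k -> ip k (gam f) =
  ip k (S (fun y => f y * f y)) - 2 * ip (fun x => k x * f x) (S f) + ip (fun x => k x * f x) f.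
Proof.
move=> bf bk; have bff := bddL2_mul bf bf.
have LSf := resL2 HD b0 bf.1; have LSff := resL2 HD b0 bff.1.
have LfSf : L2 (fun x => f x * S f x) by apply: L2_bmul => //; exact: (bddL2_bddm bf).
rewrite (_ : gam f = fun x =>
    1 * (-2 * (f x * S f x) + 1 * S (fun y => f y * f y) x) + 1 * (f x * f x)).
  rewrite (form_combr L20 L2lin ipE)//; [|exact: form_comb|exact: bff.1|exact: bk.1].
  rewrite (form_combr L20 L2lin ipE)//; [|exact: bk.1].
  have kf : (fun x => k x * f x) = (fun x => f x * k x) by fring.
  by rewrite kf !ip_mulC; ring.
by rewrite /gam; fring.
Qed.

(* For bounded f in F and k, lam f k tends to L_f(k) as b -> oo. *)
Definition lam f k := b * ip k (gam f).

(** This is the formula of [lagr_quad] with a^b in place of E, up to the order of the arguments; it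
    comes from [ip_gam] by the symmetry of S. *)
Lemma lamE f k : bddL2 f -> bddL2 k ->
  lam f k = 2 * aform f (fun x => f x * k x) - aform (fun x => f x * f x) k.
Proof.
move=> bf bk; rewrite /lam ip_gam// /aform.
have bfk := bddL2_mul bf bk; have bff := bddL2_mul bf bf.
have kf : (fun x => k x * f x) = (fun x => f x * k x) by fring.
rewrite kf (formC ipE (resL2 HD b0 bf.1) bfk.1) (formC ipE (resL2 HD b0 bff.1) bk.1).
rewrite (ip_mulC mu f f k) (formC ipE bf.1 bfk.1).
by move: (ip _ (S _)) (ip _ (S _)) (ip _ f) => *; ring.
Qed.

Lemma res_ge0 h : bddL2 h -> (forall x, 0 <= h x) -> {ae mu, forall x, 0 <= S h x}.
Proof.
move=> bh h0; have := res_ge HD b0 bh (lexx 0); rewrite oppr0; exact.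
Qed.

Lemma res_le1 h : bddL2 h -> (forall x, h x <= 1) -> {ae mu, forall x, S h x <= 1}.
Proof. by move=> bh h1; exact: (res_le HD b0 bh ler01). Qed.

Lemma ip_res_sq_le f h : bddL2 f -> bddL2 h -> (forall x, h x <= 1) ->
  ip h (S (fun y => f y * f y)) <= ip f f.
Proof.
move=> bf bh h1; have bff := bddL2_mul bf bf.
rewrite -(res_sym HD b0 bh.1 bff.1).
apply: ip_mono; [exact: (resL2 HD b0 bh.1)|exact: bf.1|exact: bff.1|exact: bf.1|].
by apply: filterS (res_le1 bh h1) => x Sh1; have := sqr_ge0 (f x); nra.
Qed.

(** Formally [lam] at k is at most M times [lam] at the weight 1, which is at most 2 a^b(f, f)
    because the integral of S(f^2) does not exceed that of f^2. *)
Lemma lam_le (M : R) f k : 0 <= M -> bddL2 f -> bddL2 k -> (forall x, k x <= M) ->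
  lam f k <= 2 * M * aform f f.
Proof.
(* The cutoffs built from this w tend to 1 wherever f or k is nonzero. *)
move=> M0 bf bk kM; pose w x := f x * f x + k x * k x.
have bw : bddL2 w by apply: form_addP; [exact: bddL2_lin|exact: bddL2_mul..].
have w0 y : 0 <= w y by rewrite /w -!expr2 addr_ge0 ?sqr_ge0.
have wf x : w x = 0 -> f x = 0 by rewrite /w; nra.
have wk x : w x = 0 -> k x = 0 by rewrite /w; nra.
have LG := gam_L2 bf; have LS := resL2 HD b0 bf.1.
have -> : 2 * M * aform f f = b * (M * (ip f f - 2 * ip f (S f) + ip f f)).
  by rewrite /aform (formC ipE LS bf.1); move: (ip f f) (ip f _) => *; ring.
rewrite /lam ler_pM2l//.
have c1 := cut_cvg w0 bw bk.1 LG wk.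
have c2 := cut_cvg w0 bw bf.1 bf.1 wf.
have c3 := cut_cvg w0 bw bf.1 LS wf.
have c4 : M * (ip f f - 2 * ip (fun x => cut w n x * f x) (S f)
    + ip (fun x => cut w n x * f x) f) @[n --> \oo]
    --> M * (ip f f - 2 * ip f (S f) + ip f f).
  exact: (cvgM (cvg_cst _) (cvgD (cvgB (cvg_cst _) (cvgM (cvg_cst _) c3)) c2)).
apply: (ler_cvg_to c1 c4); apply: nearW => n /=.
have bc := bddL2_cut n w0 bw.
apply: (@le_trans _ _ (ip (fun x => M * cut w n x) (gam f))).
  apply: ip_mono => //; [exact: (bddL2_mul bc bk).1|exact: (form_scaleP L20 L2lin M bc.1)|].
  apply: filterS (gam_ge0 HD b0 bf) => x g0; rewrite ler_wpM2r//.
  by rewrite mulrC ler_wpM2r//; case/andP: (cut01 n x w0).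
rewrite (formZl L20 ipE M bc.1 LG) ler_wpM2l// ip_gam//.
have := ip_res_sq_le bf bc (fun x => (andP (cut01 n x w0)).2); lra.
Qed.

Lemma lam_contraction (phi : R -> R) f k : normal_contraction phi -> bddL2 f ->
  bddL2 k -> (forall x, 0 <= k x) -> lam (fun x => phi (f x)) k <= lam f k.
Proof.
move=> nphi bf bk k0; rewrite /lam ler_pM2l//.
apply: ip_mono; [exact: bk.1|exact: bk.1|exact/gam_L2/nc_bddL2|exact: gam_L2|].
by apply: filterS (gam_contraction HD b0 nphi bf) => x; exact: ler_wpM2l.
Qed.

Lemma lam_ge0 f k : bddL2 f -> bddL2 k -> (forall x, 0 <= k x) -> 0 <= lam f k.
Proof.
move=> bf bk k0; rewrite /lam pmulr_rge0// -(form0l L20 ipE bk.1).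
rewrite (formC ipE L20 bk.1).
apply: ip_mono; [exact: bk.1|exact: bk.1|exact: L20|exact: gam_L2|].
by apply: filterS (gam_ge0 HD b0 bf) => x; exact: ler_wpM2l.
Qed.

Lemma lam_mono f k k' : bddL2 f -> bddL2 k -> bddL2 k' -> (forall x, k x <= k' x) ->
  lam f k <= lam f k'.
Proof.
move=> bf bk bk' kk'; rewrite /lam ler_pM2l//.
apply: ip_mono; [exact: bk.1|exact: bk'.1|exact: gam_L2|exact: gam_L2|].
by apply: filterS (gam_ge0 HD b0 bf) => x g0; exact: ler_wpM2r.
Qed.

(** Formally 2 a^b(f, f) is [lam] at the weight 1 plus b <f^2, 1 - S 1>. Both terms decrease when f
    is replaced by phi(f), as phi(f)^2 <= f^2. Cutoffs built from f^2 replace the constant 1. *)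
Lemma aform_contraction (phi : R -> R) f : normal_contraction phi -> bddL2 f ->
  aform (fun x => phi (f x)) (fun x => phi (f x)) <= aform f f.
Proof.
move=> nphi bf; have bg := nc_bddL2 nphi bf; pose g x := phi (f x).
rewrite -/g in bg *.
have bff := bddL2_mul bf bf; have bgg := bddL2_mul bg bg; pose w x := f x * f x.
have w0 y : 0 <= w y by rewrite /w -expr2 sqr_ge0.
have wf x : w x = 0 -> f x = 0 by rewrite /w; nra.
have wg x : w x = 0 -> g x = 0 by move=> /wf; rewrite /g => ->; case: nphi.
have LS := resL2 HD b0 bf.1; have LSg := resL2 HD b0 bg.1.
rewrite /aform ler_pM2l// (formC ipE LS bf.1) (formC ipE LSg bg.1).
have c1 := cut_cvg w0 bff bf.1 bf.1 wf.
have c2 := cut_cvg w0 bff bf.1 LS wf.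
have c3 := cut_cvg w0 bff bg.1 bg.1 wg.
have c4 := cut_cvg w0 bff bg.1 LSg wg.
have cl : ip (fun x => cut w n x * g x) g - 2 * ip (fun x => cut w n x * g x) (S g)
    @[n --> \oo] --> ip g g - 2 * ip g (S g).
  exact: (cvgB c3 (cvgM (cvg_cst _) c4)).
have cr : ip (fun x => cut w n x * f x) f - 2 * ip (fun x => cut w n x * f x) (S f)
    + (ip f f - ip g g) @[n --> \oo] -->
    ip f f - 2 * ip f (S f) + (ip f f - ip g g).
  exact: (cvgD (cvgB c1 (cvgM (cvg_cst _) c2)) (cvg_cst _)).
suff : ip g g - 2 * ip g (S g) <= ip f f - 2 * ip f (S f) + (ip f f - ip g g) by lra.
apply: (ler_cvg_to cl cr); apply: nearW => n /=.
have bc := bddL2_cut n w0 bff.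
have := lam_contraction nphi bf bc (fun x => (andP (cut01 n x w0)).1).
rewrite /lam ler_pM2l// !ip_gam// -/g.
rewrite -(res_sym HD b0 bc.1 bff.1) -(res_sym HD b0 bc.1 bgg.1).
have LSc := resL2 HD b0 bc.1.
(* Comparison of the killing terms: S of the cutoff is at most 1 and f^2 - g^2 is nonnegative. *)
have : ip (S (cut w n)) (fun x => f x * f x - g x * g x) <=
    ip (fun x => f x + g x) (fun x => f x - g x).
  apply: ip_mono => //; [exact: (form_addP L2lin bf.1 bg.1)|
    exact: (form_subP L2lin bff.1 bgg.1)|exact: (form_subP L2lin bf.1 bg.1)|].
  apply: filterS (res_le1 bc (fun x => (andP (cut01 n x w0)).2)) => x Sc1.
  have : 0 <= f x ^+ 2 - g x ^+ 2.
    rewrite subr_ge0 -real_normK ?num_real// -[leRHS]real_normK ?num_real//.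
    by rewrite lerXn2r//; exact: nc_norm.
  nra.
rewrite (formBr L20 L2lin ipE bff.1 bgg.1 LSc).
rewrite (formBr L20 L2lin ipE bf.1 bg.1 (form_addP L2lin bf.1 bg.1)).
rewrite (formDl L20 L2lin ipE bf.1 bg.1 bf.1) (formDl L20 L2lin ipE bf.1 bg.1 bg.1).
rewrite (formC ipE bf.1 bg.1) /w; lra.
Qed.

(* Formally lam f 1 = 2 a(f, f) - b <f^2, 1 - S 1>, and the killing term is at most
   a(f, f); the cutoffs h and k replace the constant 1, which need not be in L2. *)
Lemma aform_le_of_lam (C : R) f : bddL2 f ->
  (forall k, bddL2 k -> (forall x, 0 <= k x <= 1) -> mu.-integrable setT (EFin \o k) ->
     lam f k <= C) ->
  aform f f <= C.
Proof.
move=> bf hC; have bff := bddL2_mul bf bf; pose w x := f x * f x.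
have w0 y : 0 <= w y by rewrite /w -expr2 sqr_ge0.
have wf x : w x = 0 -> f x = 0 by rewrite /w; nra.
have LS := resL2 HD b0 bf.1; have LSff := resL2 HD b0 bff.1.
have bc n := bddL2_cut n w0 bff; have c01 n x := cut01 n x w0.
have bcf n := bddL2_mul (bc n) bf.
have c1 := cut_cvg w0 bff bf.1 bf.1 wf.
have c2 := cut_cvg w0 bff bf.1 LS wf.
have [C' C'E] : exists C', C' = C / b by exists (C / b).
have hk n : ip (cut w n) (gam f) <= C'.
  rewrite C'E ler_pdivlMr// mulrC; apply: hC => //.
  apply: (le_integrableR (g := fun x => n%:R * w x + 0 * w x)) => [|x|].
  - by case: (bc n) => -[].
  - rewrite mul0r addr0; have /andP[h _] := c01 n x; rewrite ger0_norm//.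
    by rewrite /cut ge_min lexx.
  - by apply: integrable_comb; exact: (L2_mul bf.1 bf.1).
(* Double cutoff: nonnegativity of the formal integral of c_m(x) c_n(y) (f(y) - f(x))^2 bounds 2
   <c_n f, S(c_m f)> by <c_m, S(f^2)> + <c_n, S(f^2)>, and [hk] bounds both. Letting n and then m
   tend to infinity leaves <f, f> - <f, S f> <= C / b. *)
have key n m : 2 * ip (fun x => cut w n x * f x) (S (fun x => cut w m x * f x)) <=
    2 * C' + 2 * ip (fun x => cut w m x * f x) (S f) - ip (fun x => cut w m x * f x) f
    + 2 * ip (fun x => cut w n x * f x) (S f) - ip (fun x => cut w n x * f x) f.
  have cn0 x := (andP (c01 n x)).1; have cm0 x := (andP (c01 m x)).1.
  have bffc := bddL2_mul bff (bc n); have bfc := bddL2_mul bf (bc n).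
  have LSffc := resL2 HD b0 bffc.1; have LSfc := resL2 HD b0 bfc.1.
  have LSc := resL2 HD b0 (bc n).1; have LSm := resL2 HD b0 (bc m).1.
  have bmf := bddL2_mul bf (bc m); have bmff := bddL2_mul bf bmf.
  have LSfc' : L2 (fun x => f x * S (fun y => f y * cut w n y) x).
    exact: (L2_bmul (bddL2_bddm bf)).
  have LffSc : L2 (fun x => f x * f x * S (cut w n) x).
    exact: (L2_bmul (bddL2_bddm bff)).
  have sq : 0 <= ip (cut w m) (S (fun y => f y * f y * cut w n y))
      - 2 * ip (fun x => f x * cut w m x) (S (fun y => f y * cut w n y))
      + ip (fun x => f x * f x * cut w m x) (S (cut w n)).
    have -> : ip (fun x => f x * cut w m x) (S (fun y => f y * cut w n y)) =
        ip (cut w m) (fun x => f x * S (fun y => f y * cut w n y) x) by rewrite ip_mulC.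
    have -> : ip (fun x => f x * f x * cut w m x) (S (cut w n)) =
        ip (cut w m) (fun x => f x * f x * S (cut w n) x).
      by rewrite (ip_mulC mu (fun x => f x * f x)).
    rewrite -(mul1r (ip _ (S _))) -mulNr -(form_combr L20 L2lin ipE)//; last exact: (bc m).1.
    rewrite -(mul1r (ip _ (fun x => _ * S _ _))) -[X in X + _]mul1r.
    rewrite -(form_combr L20 L2lin ipE)//; [|exact: form_comb|exact: (bc m).1].
    rewrite -(form0l L20 ipE (bc m).1) (formC ipE L20 (bc m).1).
    apply: ip_mono; [exact: (bc m).1|exact: (bc m).1|exact: L20| |].
      by apply: (form_comb L20 L2lin) => //; exact: (form_comb L20 L2lin).
    apply: filterS (res_square_mul HD b0 bf (bc n) cn0) => x h.
    by rewrite ler_wpM2l//; lra.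
  have h1 : ip (cut w m) (S (fun y => f y * f y * cut w n y)) <=
      ip (cut w m) (S (fun y => f y * f y)).
    rewrite -(res_sym HD b0 (bc m).1 bffc.1) -(res_sym HD b0 (bc m).1 bff.1).
    apply: ip_mono => //; [exact: bffc.1|exact: bff.1|].
    apply: filterS (res_ge0 (bc m) cm0) => x h; rewrite ler_wpM2l//.
    by rewrite ler_piMr ?(andP (c01 n x)).2// -expr2 sqr_ge0.
  have h2 : ip (fun x => f x * f x * cut w m x) (S (cut w n)) <=
      ip (cut w n) (S (fun y => f y * f y)).
    rewrite -(res_sym HD b0 (bc n).1 bff.1) (formC ipE LSc bff.1).
    apply: ip_mono => //; [exact: (bddL2_mul bff (bc m)).1|exact: bff.1|].
    apply: filterS (res_ge0 (bc n) cn0) => x h; rewrite ler_wpM2r//.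
    by rewrite ler_piMr ?(andP (c01 m x)).2// -expr2 sqr_ge0.
  have := hk n; have := hk m; rewrite !ip_gam//.
  have fcE p : (fun x => f x * cut w p x) = (fun x => cut w p x * f x) by fring.
  move: sq; rewrite !fcE in LSfc *; rewrite (formC ipE (bcf m).1 LSfc).
  by rewrite (res_sym HD b0 (bcf n).1 (bcf m).1); lra.
have LSm m := resL2 HD b0 (bcf m).1.
have key2 m : 0 <= 2 * C' - ip (fun x => cut w m x * f x) f + 2 * ip f (S f) - ip f f.
  have c3 := cut_cvg w0 bff bf.1 (LSm m) wf.
  have cl : 2 * ip (fun x => cut w n x * f x) (S (fun x => cut w m x * f x)) @[n --> \oo]
      --> 2 * ip f (S (fun x => cut w m x * f x)).
    exact: (cvgM (cvg_cst _) c3).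
  have cr : 2 * C' + 2 * ip (fun x => cut w m x * f x) (S f) - ip (fun x => cut w m x * f x) f
    + 2 * ip (fun x => cut w n x * f x) (S f) - ip (fun x => cut w n x * f x) f @[n --> \oo]
    --> 2 * C' + 2 * ip (fun x => cut w m x * f x) (S f) - ip (fun x => cut w m x * f x) f
    + 2 * ip f (S f) - ip f f.
    exact: (cvgB (cvgD (cvg_cst _) (cvgM (cvg_cst _) c2)) c1).
  suff : 2 * ip f (S (fun x => cut w m x * f x)) <=
      2 * C' + 2 * ip (fun x => cut w m x * f x) (S f)
      - ip (fun x => cut w m x * f x) f + 2 * ip f (S f) - ip f f.
    by rewrite -(res_sym HD b0 bf.1 (bcf m).1) (formC ipE LS (bcf m).1); lra.
  by apply: (ler_cvg_to cl cr); apply: nearW => n; exact: key.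
have c5 : 2 * C' - ip (fun x => cut w m x * f x) f + 2 * ip f (S f) - ip f f @[m --> \oo]
  --> 2 * C' - ip f f + 2 * ip f (S f) - ip f f.
  exact: (cvgB (cvgD (cvgB (cvg_cst _) c1) (cvg_cst _)) (cvg_cst _)).
have : 0 <= 2 * C' - ip f f + 2 * ip f (S f) - ip f f.
  by apply: (ler_cvg_to (cvg_cst (0 : R)) c5); exact: nearW.
by move=> h; rewrite /aform mulrC -ler_pdivlMr// -C'E (formC ipE LS bf.1); lra.
Qed.

Lemma lam_le_sup (U : R) f k : bddL2 f -> (forall x, `|f x| <= U) -> bddL2 k ->
  (forall x, 0 <= k x) -> mu.-integrable setT (EFin \o k) ->
  lam f k <= b * (4 * U ^+ 2 * \int[mu]_x k x).
Proof.
move=> bf fU bk k0 Ik; rewrite /lam ler_pM2l// -RintegralZl// ip.unlock.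
apply: ae_le_Rintegral; first by apply: L2_mul; [exact: bk.1|exact: gam_L2].
  exact: (integrableZl measurableT (4 * U ^+ 2) Ik).
by apply: filterS (gam_le_sup HD b0 bf fU) => x g4; rewrite mulrC ler_wpM2r.
Qed.

End Integrated.

(** * Comparison of a^b(u h, u h) with the Lagrangian of u *)

Section Products.
Context {R : realType} {d : measure_display} {T : measurableType d}.
Context (mu : {measure set T -> \bar R}) (F : set (T -> R)).
Context (E : (T -> R) -> (T -> R) -> R).
Hypothesis HD : is_dirichlet_form mu F E.
Implicit Types (f g h k u v w : T -> R) (c : R).
Local Notation ip := (ip mu).
Local Notation bddL2 := (bddL2 mu).
Variable b : R.
Hypothesis b0 : 0 < b.
Local Notation gam := (gam mu F E b).
Local Notation lam := (lam mu F E b).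
Local Notation aform := (aform mu F E b).
Let L20 := L2_0 mu.
Let L2lin := @L2_lin _ _ _ mu.
Let ipE := ip_is_form mu.

Lemma lamZ f k c : bddL2 f -> bddL2 k -> lam f (fun x => c * k x) = c * lam f k.
Proof.
by move=> bf bk; rewrite /lam (formZl L20 ipE c bk.1 (gam_L2 HD b0 bf)); ring.
Qed.

Lemma lam_sub_le f g k : bddL2 f -> bddL2 g -> bddL2 k -> (forall x, 0 <= k x) ->
  lam f k <= 2 * lam (fun x => f x - g x) k + 2 * lam g k.
Proof.
move=> bf bg bk k0; have Gd := gam_L2 HD b0 (form_subP (@bddL2_lin _ _ _ mu) bf bg).
have Gg := gam_L2 HD b0 bg.
have h1 : ip k (gam f) <= ip k (fun x => 2 * gam (fun x => f x - g x) x + 2 * gam g x).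
  apply: ip_mono; [exact: bk.1|exact: bk.1|exact: gam_L2|exact: (form_comb L20 L2lin)|].
  by apply: filterS (gam_sub_le HD b0 bf bg) => x; exact: ler_wpM2l.
move: h1; rewrite (form_combr L20 L2lin ipE _ _ Gd Gg bk.1) /lam -(ler_pM2l b0); lra.
Qed.

Lemma lam_mul_le (U : R) u h k : bddL2 u -> bddL2 h -> bddL2 k -> (forall x, `|u x| <= U) ->
  (forall x, 0 <= k x) ->
  lam (fun x => u x * h x) k <= 2 * lam u (fun x => h x * h x * k x) + 2 * U ^+ 2 * lam h k.
Proof.
move=> bu bh bk uU k0.
have Gu := gam_L2 HD b0 bu; have Gh := gam_L2 HD b0 bh.
have Ghu := L2_bmul (bddm_mul (bddL2_bddm bh) (bddL2_bddm bh)) Gu.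
have h1 : ip k (gam (fun x => u x * h x)) <=
    ip k (fun x => 2 * (h x * h x * gam u x) + 2 * U ^+ 2 * gam h x).
  apply: ip_mono; [exact: bk.1|exact: bk.1|exact/(gam_L2 HD b0)/bddL2_mul| |].
    exact: (form_comb L20 L2lin).
  by apply: filterS (gam_mul_le HD b0 bu bh uU) => x; exact: ler_wpM2l.
move: h1; rewrite (form_combr L20 L2lin ipE _ _ Ghu Gh bk.1).
rewrite -(ip_mulC mu (fun x => h x * h x)) /lam -(ler_pM2l b0); lra.
Qed.

Lemma lam_mul_ge (U : R) u h k : bddL2 u -> bddL2 h -> bddL2 k -> (forall x, `|u x| <= U) ->
  (forall x, 0 <= k x) ->
  lam u (fun x => h x * h x * k x) <= 2 * lam (fun x => u x * h x) k + 2 * U ^+ 2 * lam h k.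
Proof.
move=> bu bh bk uU k0.
have Gu := gam_L2 HD b0 bu; have Gh := gam_L2 HD b0 bh.
have Guh := gam_L2 HD b0 (bddL2_mul bu bh).
have Ghu := L2_bmul (bddm_mul (bddL2_bddm bh) (bddL2_bddm bh)) Gu.
have h1 : ip k (fun x => h x * h x * gam u x) <=
    ip k (fun x => 2 * gam (fun x => u x * h x) x + 2 * U ^+ 2 * gam h x).
  apply: ip_mono; [exact: bk.1|exact: bk.1|exact: Ghu| |].
    exact: (form_comb L20 L2lin).
  by apply: filterS (gam_mul_ge HD b0 bu bh uU) => x; exact: ler_wpM2l.
move: h1; rewrite (form_combr L20 L2lin ipE _ _ Guh Gh bk.1).
rewrite -(ip_mulC mu (fun x => h x * h x)) /lam -(ler_pM2l b0); lra.
Qed.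

(** By [aform_le_of_lam] it is enough to treat weights k with values in [0, 1]: combine [lam_mul_le]
    with h^2 k <= H h and with [lam_le] for h. *)
Lemma aform_mul_le (U H : R) u h : bddL2 u -> bddL2 h -> (forall x, `|u x| <= U) ->
  (forall x, 0 <= h x <= H) ->
  aform (fun x => u x * h x) (fun x => u x * h x) <= 2 * H * lam u h + 4 * U ^+ 2 * aform h h.
Proof.
move=> bu bh uU hH; apply: (aform_le_of_lam HD b0 (bddL2_mul bu bh)) => k bk k01 _.
apply: le_trans (lam_mul_le bu bh bk uU (fun x => (andP (k01 x)).1)) _.
have h1 : lam u (fun x => h x * h x * k x) <= lam u (fun x => H * h x).
  apply: (lam_mono HD b0 bu).
  - by do ?apply: bddL2_mul.
  - by apply: bddL2_bmul => //; exact: bddm_cst.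
  - move=> x; have /andP[h0 hH'] := hH x; have /andP[k0 k1] := k01 x.
    have : h x * h x <= H * h x by rewrite ler_wpM2r.
    have : h x * h x * k x <= h x * h x by rewrite ler_piMr// mulr_ge0.
    lra.
have h2 := lam_le HD b0 ler01 bh bk (fun x => (andP (k01 x)).2).
have : 2 * U ^+ 2 * lam h k <= 2 * U ^+ 2 * (2 * 1 * aform h h).
  by rewrite ler_wpM2l// mulr_ge0// sqr_ge0.
by rewrite lamZ// in h1; lra.
Qed.

(** Apply [lam_mul_ge] with cutoffs k increasing to the indicator of {h != 0}; [lam_le] bounds [lam]
    of u h and of h at k by twice the values of a^b. *)
Lemma lam_sq_le (U : R) u h : bddL2 u -> bddL2 h -> (forall x, `|u x| <= U) ->
  lam u (fun x => h x * h x) <=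
  4 * aform (fun x => u x * h x) (fun x => u x * h x) + 4 * U ^+ 2 * aform h h.
Proof.
move=> bu bh uU; have bhh := bddL2_mul bh bh; pose w x := h x * h x.
have w0 y : 0 <= w y by rewrite /w -expr2 sqr_ge0.
have c1 := cut_cvg w0 bhh bhh.1 (gam_L2 HD b0 bu) (fun x => id).
apply: (cvgr_to_le (cvgM (cvg_cst b) c1)); apply: nearW => n /=.
have bc := bddL2_cut n w0 bhh; have c01 x := cut01 n x w0.
have buh := bddL2_mul bu bh.
have := lam_mul_ge bu bh bc uU (fun x => (andP (c01 x)).1).
have h2 := lam_le HD b0 ler01 bh bc (fun x => (andP (c01 x)).2).
have h3 := lam_le HD b0 ler01 buh bc (fun x => (andP (c01 x)).2).
have : 2 * U ^+ 2 * lam h (cut w n) <= 2 * U ^+ 2 * (2 * 1 * aform h h).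
  by rewrite ler_wpM2l// mulr_ge0// sqr_ge0.
rewrite /(lam u) (_ : (fun x => h x * h x * cut w n x) = (fun x => cut w n x * (h x * h x))).
  move: h3; lra.
by fring.
Qed.

End Products.

(** * Passage to the limit: the algebra of bounded elements and the Lagrangian of E *)

Section Lagrangian.
Context {R : realType} {d : measure_display} {T : measurableType d}.
Context (mu : {measure set T -> \bar R}) (F : set (T -> R)).
Context (E : (T -> R) -> (T -> R) -> R).
Hypothesis HD : is_dirichlet_form mu F E.
Implicit Types (f g h k u v w : T -> R) (c : R).
Local Notation B := (bdd_part F).
Local Notation bddL2 := (bddL2 mu).
Local Notation aform := (aform mu F E).
Local Notation lam := (lam mu F E).
Let F0 := dirichlet_0 HD.
Let Flin := dirichlet_lin HD.
Let FE := dirichlet_form_on HD.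
Let nR0 n : (0 : R) < n.+1%:R.
Proof. by rewrite ltr0n. Qed.

Lemma bdd_part_F f : B f -> F f.
Proof. by case. Qed.

Lemma bdd_part_bddL2 f : B f -> bddL2 f.
Proof. by move=> [_ bf Ff]; split => //; exact: (dirichlet_L2 HD). Qed.

Let BF := bdd_part_F.
Let BL := bdd_part_bddL2.

Lemma bddL2_bdd_part f : bddL2 f -> F f -> B f.
Proof. by move=> [[mf _] bf] Ff; split. Qed.

Lemma bdd_part_0 : B (fun=> 0).
Proof. by apply: bddL2_bdd_part => //; exact: bddL2_0. Qed.

Lemma bdd_part_lin a f g : B f -> B g -> B (fun x => a * f x + g x).
Proof.
move=> Bf Bg; apply: bddL2_bdd_part; first by apply: bddL2_lin; exact: BL.
by apply: Flin; exact: BF.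
Qed.

(** The values of a^b at phi(f) are at most a^b(f, f) <= E(f, f) for every b, so [form_of_aform]
    yields membership in F and the inequality at once. *)
Lemma bdd_part_nc (phi : R -> R) f : normal_contraction phi -> B f ->
  B (fun x => phi (f x)) /\ E (fun x => phi (f x)) (fun x => phi (f x)) <= E f f.
Proof.
move=> nphi Bf; have bg := nc_bddL2 nphi (BL Bf).
have [|Fg Eg _] := @form_of_aform _ _ _ _ _ _ HD (fun x => phi (f x)) (E f f) bg.1.
  move=> n; apply: le_trans (aform_le HD (nR0 n) (BF Bf)).
  exact: (aform_contraction HD (nR0 n) nphi (BL Bf)).
by split => //; exact: bddL2_bdd_part.
Qed.

Let B0 := bdd_part_0.
Let Blin := bdd_part_lin.

Lemma bdd_part_scale a f : B f -> B (fun x => a * f x).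
Proof. exact: form_scaleP. Qed.

(* x^2 / (2 K) agrees with a normal contraction on [-K, K]. *)
Lemma bdd_part_sq f : B f -> B (fun x => f x * f x).
Proof.
move=> Bf; have [_ [M fM] _] := Bf; pose K := `|M| + 1.
have K0 : 0 < K by rewrite ltr_wpDl.
pose phi (x : R) := Num.min `|x| K ^+ 2 / (2 * K).
have nphi : normal_contraction phi.
  split; first by rewrite /phi normr0 min_l ?ltW// expr0n mul0r.
  move=> x y; rewrite /phi -mulrBl normrM [X in _ * X]ger0_norm; last first.
    by rewrite invr_ge0 mulr_ge0// ltW.
  rewrite ler_pdivrMr ?mulr_gt0// subr_sqr normrM.
  have m0 (z : R) : 0 <= Num.min `|z| K <= K by rewrite le_min normr_ge0 (ltW K0) ge_min lexx orbT.
  have /andP[x0 xK] := m0 x; have /andP[y0 yK] := m0 y.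
  apply: ler_pM => //; last by rewrite ger0_norm ?addr_ge0//; lra.
  have := lerB_dist x y; have := lerB_dist y x; rewrite (distrC y x).
  rewrite ler_norml => h1 h2.
  by case: (leP `|x| K) => ?; case: (leP `|y| K) => ?; apply/andP; split; lra.
have [Bphi _] := bdd_part_nc nphi Bf.
rewrite (_ : (fun x => f x * f x) = fun x => 2 * K * phi (f x)); first exact: bdd_part_scale.
apply/funext => x; rewrite /phi min_l; last first.
  by rewrite (le_trans (fM x))// (le_trans (ler_norm M))// lerDl.
by rewrite real_normK ?num_real//; field; rewrite gt_eqF.
Qed.

Lemma bdd_part_mul f g : B f -> B g -> B (fun x => f x * g x).
Proof.
move=> Bf Bg.
have Bp := bdd_part_sq (form_addP Blin Bf Bg).
have Bm := bdd_part_sq (form_subP Blin Bf Bg).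
rewrite (_ : (fun x => f x * g x) = fun x => 4^-1 * ((f x + g x) * (f x + g x))
  + (- 4^-1) * ((f x - g x) * (f x - g x))); first exact: (form_comb B0 Blin).
by apply/funext => x; field.
Qed.

Lemma bdd_part_min1 f : B f -> B (fun x => Num.min (f x) 1).
Proof.
move=> Bf; apply: (bdd_part_nc (phi := fun x => Num.min x 1) _ Bf).1.
split; first by rewrite min_l.
move=> x y; have := lerB_dist x y; rewrite ler_norml => _.
have := ler_norm (x - y); have := ler_norm (- (x - y)); rewrite normrN.
by case: (leP x 1) => ?; case: (leP y 1) => ? ? ?; apply/andP; split; lra.
Qed.

Lemma T1_normal_contraction : normal_contraction (@T1 R).
Proof.
split; first by rewrite /T1 maxxx min_l.
move=> x y; have := ler_norm (x - y); have := ler_norm (- (x - y)).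
rewrite normrN ler_norml /T1.
case: (leP x 0) => ?; case: (leP y 0) => ?; rewrite ?(min_l ler01);
  try case: (leP x 1) => ?; try case: (leP y 1) => ?; move=> *; apply/andP; split; lra.
Qed.

Local Notation L := (lagr_quad E).

Lemma lagr_quad_cvg f h : B f -> B h -> lam n.+1%:R f h @[n --> \oo] --> L f h.
Proof.
move=> Bf Bh; have Bfh := bdd_part_mul Bf Bh; have Bff := bdd_part_mul Bf Bf.
under eq_cvg do rewrite (lamE HD (nR0 _) (BL Bf) (BL Bh)).
rewrite /L (formC FE (BF Bfh) (BF Bf)).
apply: cvgB; last exact: (aform_cvg HD (BF Bff) (BF Bh)).
by apply: cvgM; [exact: cvg_cst|exact: (aform_cvg HD (BF Bf) (BF Bfh))].
Qed.

Lemma lagr_quad_contraction (phi : R -> R) f h : normal_contraction phi -> B f -> B h ->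
  nonneg_fun h -> L (fun x => phi (f x)) h <= L f h.
Proof.
move=> nphi Bf Bh h0; have [Bpf _] := bdd_part_nc nphi Bf.
apply: (ler_cvg_to (lagr_quad_cvg Bpf Bh) (lagr_quad_cvg Bf Bh)).
by apply: nearW => n; apply: lam_contraction => //; exact: BL.
Qed.

Lemma lagr_quad_ge0 f h : B f -> B h -> nonneg_fun h -> 0 <= L f h.
Proof.
move=> Bf Bh h0; apply: (ler_cvg_to (cvg_cst 0) (lagr_quad_cvg Bf Bh)).
by apply: nearW => n; apply: lam_ge0 => //; exact: BL.
Qed.

Lemma lagr_quad_mono f h k : B f -> B h -> B k -> (forall x, h x <= k x) -> L f h <= L f k.
Proof.
move=> Bf Bh Bk hk; apply: (ler_cvg_to (lagr_quad_cvg Bf Bh) (lagr_quad_cvg Bf Bk)).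
by apply: nearW => n; apply: lam_mono => //; exact: BL.
Qed.

Lemma lagr_quad_le (M : R) f h : 0 <= M -> B f -> B h -> (forall x, h x <= M) ->
  L f h <= 2 * M * E f f.
Proof.
move=> M0 Bf Bh hM; apply: (cvgr_to_le (lagr_quad_cvg Bf Bh)); apply: nearW => n.
apply: le_trans (lam_le HD (nR0 n) M0 (BL Bf) (BL Bh) hM) _.
by rewrite ler_wpM2l ?mulr_ge0//; exact: (aform_le HD (nR0 n) (BF Bf)).
Qed.

Lemma form_mul_le (U H : R) u h : B u -> B h -> (forall x, `|u x| <= U) ->
  (forall x, 0 <= h x <= H) ->
  E (fun x => u x * h x) (fun x => u x * h x) <= 2 * H * L u h + 4 * U ^+ 2 * E h h.
Proof.
move=> Bu Bh uU hH; have Buh := bdd_part_mul Bu Bh.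
apply: (ler_cvg_to (aform_cvg HD (BF Buh) (BF Buh)) (cvgD (cvgM (cvg_cst (2 * H))
  (lagr_quad_cvg Bu Bh)) (cvg_cst (4 * U ^+ 2 * E h h)))).
apply: nearW => n /=; apply: le_trans (aform_mul_le HD (nR0 n) (BL Bu) (BL Bh) uU hH) _.
rewrite lerD2l; apply: ler_wpM2l; first by rewrite mulr_ge0// sqr_ge0.
exact: (aform_le HD (nR0 n) (BF Bh)).
Qed.

Lemma lagr_quad_sq_le (U : R) u h : B u -> B h -> (forall x, `|u x| <= U) ->
  L u (fun x => h x * h x) <=
  4 * E (fun x => u x * h x) (fun x => u x * h x) + 4 * U ^+ 2 * E h h.
Proof.
move=> Bu Bh uU; have Buh := bdd_part_mul Bu Bh; have Bhh := bdd_part_mul Bh Bh.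
apply: (cvgr_to_le (lagr_quad_cvg Bu Bhh)); apply: nearW => n.
apply: le_trans (lam_sq_le HD (nR0 n) (BL Bu) (BL Bh) uU) _.
have := aform_le HD (nR0 n) (BF Buh).
have : 4 * U ^+ 2 * aform n.+1%:R h h <= 4 * U ^+ 2 * E h h.
  apply: ler_wpM2l; first by rewrite mulr_ge0// sqr_ge0.
  exact: (aform_le HD (nR0 n) (BF Bh)).
lra.
Qed.

Lemma lagr_quadZ a f h : B f -> B h -> L f (fun x => a * h x) = a * L f h.
Proof.
move=> Bf Bh; have Bfh := bdd_part_mul Bf Bh; have Bff := bdd_part_mul Bf Bf.
rewrite /lagr_quad (formZr F0 Flin FE a (BF Bff) (BF Bh)).
rewrite (_ : (fun x => f x * (a * h x)) = fun x => a * (f x * h x)); last by fring.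
rewrite (formZl F0 FE a (BF Bfh) (BF Bf)); ring.
Qed.

Lemma lagr_quadD f h k : B f -> B h -> B k -> L f (fun x => h x + k x) = L f h + L f k.
Proof.
move=> Bf Bh Bk; have Bfh := bdd_part_mul Bf Bh; have Bff := bdd_part_mul Bf Bf.
have Bfk := bdd_part_mul Bf Bk.
rewrite /lagr_quad (formDr F0 Flin FE (BF Bh) (BF Bk) (BF Bff)).
rewrite (_ : (fun x => f x * (h x + k x)) = fun x => f x * h x + f x * k x); last by fring.
rewrite (formDl F0 Flin FE (BF Bfh) (BF Bfk) (BF Bf)); ring.
Qed.

(** Polarisation expanded; symmetry and linearity in f are read off from this form. *)
Lemma lagr_ofE f g h : B f -> B g -> B h -> lagr_of E f g h =
  E (fun x => f x * h x) g + E (fun x => g x * h x) f - E (fun x => f x * g x) h.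
Proof.
move=> Bf Bg Bh; have Bfh := BF (bdd_part_mul Bf Bh); have Bgh := BF (bdd_part_mul Bg Bh).
have Bfg := BF (bdd_part_mul Bf Bg); have Bff := BF (bdd_part_mul Bf Bf).
have Bgg := BF (bdd_part_mul Bg Bg).
have {}Bf := BF Bf; have {}Bg := BF Bg; have {}Bh := BF Bh.
rewrite /lagr_of /lagr_quad.
have -> : (fun x => (f x + g x) * h x) = fun x => f x * h x + g x * h x by fring.
have -> : (fun x => (f x - g x) * h x) = fun x => f x * h x - g x * h x by fring.
have -> : (fun x => (f x + g x) * (f x + g x)) =
   fun x => 1 * (f x * f x) + 1 * (2 * (f x * g x) + 1 * (g x * g x)) by fring.
have -> : (fun x => (f x - g x) * (f x - g x)) =
   fun x => 1 * (f x * f x) + 1 * ((-2) * (f x * g x) + 1 * (g x * g x)) by fring.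
have c1 := form_comb F0 Flin 2 1 Bfg Bgg; have c2 := form_comb F0 Flin (-2) 1 Bfg Bgg.
rewrite (form_combl F0 Flin FE 1 1 Bff c1 Bh) (form_combl F0 Flin FE 2 1 Bfg Bgg Bh).
rewrite (form_combl F0 Flin FE 1 1 Bff c2 Bh) (form_combl F0 Flin FE (-2) 1 Bfg Bgg Bh).
rewrite (formDl F0 Flin FE Bfh Bgh (form_addP Flin Bf Bg)).
rewrite (formBl F0 Flin FE Bfh Bgh (form_subP Flin Bf Bg)).
rewrite (formDr F0 Flin FE Bf Bg Bfh) (formDr F0 Flin FE Bf Bg Bgh).
rewrite (formBr F0 Flin FE Bf Bg Bfh) (formBr F0 Flin FE Bf Bg Bgh).
by field.
Qed.

Lemma lagr_of_diag f h : B f -> B h -> lagr_of E f f h = L f h.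
Proof. by move=> Bf Bh; rewrite lagr_ofE// /lagr_quad; ring. Qed.

Lemma lagr_ofC f g h : B f -> B g -> B h -> lagr_of E f g h = lagr_of E g f h.
Proof.
move=> Bf Bg Bh; rewrite !lagr_ofE// [E _ g + _]addrC.
by rewrite (_ : (fun x => g x * f x) = fun x => f x * g x)//; fring.
Qed.

Lemma lagr_of_linl a f f' g h : B f -> B f' -> B g -> B h ->
  lagr_of E (fun x => a * f x + f' x) g h = a * lagr_of E f g h + lagr_of E f' g h.
Proof.
move=> Bf Bf' Bg Bh; rewrite !lagr_ofE//; last exact: Blin.
have FM u v : B u -> B v -> F (fun x => u x * v x) by move=> *; exact/BF/bdd_part_mul.
have -> : (fun x => (a * f x + f' x) * h x) = fun x => a * (f x * h x) + f' x * h x by fring.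
have -> : (fun x => (a * f x + f' x) * g x) = fun x => a * (f x * g x) + f' x * g x by fring.
have -> : (fun x => a * f x + f' x) = fun x => a * f x + 1 * f' x by fring.
rewrite (form_combr F0 Flin FE a 1 (BF Bf) (BF Bf') (FM _ _ Bg Bh)).
have [_ El _] := FE.
rewrite (El a _ _ _ (FM _ _ Bf Bh) (FM _ _ Bf' Bh) (BF Bg)).
rewrite (El a _ _ _ (FM _ _ Bf Bg) (FM _ _ Bf' Bg) (BF Bh)).
ring.
Qed.

Lemma lagr_of_linr a f g h k : B f -> B g -> B h -> B k ->
  lagr_of E f g (fun x => a * h x + k x) = a * lagr_of E f g h + lagr_of E f g k.
Proof.
move=> Bf Bg Bh Bk.
have Bp := form_addP Blin Bf Bg; have Bm := form_subP Blin Bf Bg.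
have Bah := bdd_part_scale a Bh.
by rewrite /lagr_of !lagr_quadD// !lagr_quadZ//; field.
Qed.

Lemma lagr_form_on h : B h -> nonneg_fun h -> is_bilinear_form B (fun f g => lagr_of E f g h).
Proof.
move=> Bh h0; split.
- by move=> f g Bf Bg; exact: lagr_ofC.
- by move=> a f f' g Bf Bf' Bg; exact: lagr_of_linl.
- by move=> f Bf; rewrite lagr_of_diag//; exact: lagr_quad_ge0.
Qed.

Lemma lagr_of_in_dual f g : B f -> B g -> in_dual B (lagr_of E f g).
Proof.
move=> Bf Bg; split; first by move=> a h k Bh Bk; exact: lagr_of_linr.
have Bp := form_addP Blin Bf Bg; have Bm := form_subP Blin Bf Bg.
pose p x := f x + g x; pose m x := f x - g x.
(* From |L_k(h)| <= 2 M E(k, k) for k = f + g and k = f - g, divided by the 4 of the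
   polarisation. *)
exists (2^-1 * (E p p + E m m)) => h M Bh hM.
(* On an empty space M may be negative; there every function is the zero function. *)
have [[x0 _]|nx] := pselect (exists x : T, True); last first.
  have empty k : k = fun=> 0 by apply/funext => x; exfalso; apply: nx; exists x.
  rewrite (empty p) (empty m) (empty f) (empty h) lagr_ofE//.
  have mul0 : (fun x : T => (0 : R) * 0) = fun=> 0 by fring.
  have z k : F k -> E (fun=> 0) k = 0 by exact: (form0l F0 FE).
  by rewrite (empty g) !mul0 !z ?(BF B0)// subr0 addr0 normr0; lra.
have M0 : 0 <= M by rewrite (le_trans _ (hM x0)).
have bound k : B k -> - (2 * M * E k k) <= L k h <= 2 * M * E k k.
  move=> Bk; apply/andP; split; last first.
    by apply: lagr_quad_le => // x; rewrite (le_trans (ler_norm _)).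
  rewrite lerNl -mulN1r -lagr_quadZ//; apply: lagr_quad_le => //.
    exact: bdd_part_scale.
  by move=> x; rewrite mulN1r (le_trans (ler_norm _))// normrN.
rewrite /lagr_of ler_norml; have := bound _ Bp; have := bound _ Bm.
rewrite -/p -/m; move: (L p h) (L m h) (E p p) (E m m) => a b c e /andP[? ?] /andP[? ?].
by apply/andP; split; lra.
Qed.

Lemma bdd_algebra_bdd_part : bdd_algebra_min1 B.
Proof.
split; [exact: B0|exact: Blin|exact: bdd_part_mul|by move=> f []|exact: bdd_part_min1].
Qed.

Lemma is_lagrangian_bdd_part : is_lagrangian B (lagr_of E).
Proof.
split; first exact: bdd_algebra_bdd_part; split.
- exact: lagr_of_in_dual.
- by move=> f g h; exact: lagr_ofC.
- by move=> a f f' g h; exact: lagr_of_linl.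
- by move=> f h Bf Bh h0; rewrite lagr_of_diag//; exact: lagr_quad_ge0.
- move=> f h Bf Bh h0; have [BT _] := bdd_part_nc T1_normal_contraction Bf.
  by rewrite !lagr_of_diag//; exact: (lagr_quad_contraction T1_normal_contraction).
Qed.

Lemma nc_operate_lagr_bdd_part : nc_operate_lagr B (lagr_of E).
Proof.
split=> [phi f nphi Bf|phi f h nphi Bf Bh h0]; have [Bp _] := bdd_part_nc nphi Bf => //.
by rewrite !lagr_of_diag//; exact: lagr_quad_contraction.
Qed.

End Lagrangian.

(** * Sup-norm closability of E and of its Lagrangian *)

Section Closability.
Context {R : realType} {d : measure_display} {T : measurableType d}.
Context (mu : {measure set T -> \bar R}) (F : set (T -> R)).
Context (E : (T -> R) -> (T -> R) -> R).
Hypothesis HD : is_dirichlet_form mu F E.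
Implicit Types (f g h k v w : T -> R) (u : nat -> T -> R) (c : R).
Local Notation B := (bdd_part F).
Local Notation ip := (ip mu).
Local Notation bddL2 := (bddL2 mu).
Local Notation L := (lagr_quad E).
Let F0 := dirichlet_0 HD.
Let Flin := dirichlet_lin HD.
Let FE := dirichlet_form_on HD.
Let FL2 := dirichlet_L2 HD.
Let BF := @bdd_part_F _ _ _ F.
Let BL := bdd_part_bddL2 HD.
Let Blin := bdd_part_lin HD.
Let B0 := bdd_part_0 HD.
Let L20 := L2_0 mu.
Let L2lin := @L2_lin _ _ _ mu.
Let ipE := ip_is_form mu.

Let sq_small c (e : R) : 0 <= c -> 0 < e -> exists U : R, 0 < U /\ U ^+ 2 * c < e.
Proof.
move=> c0 e0; have c1 : 0 < c + 1 by lra.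
(* As U <= 1, U^2 c <= U c < U (c + 1) <= e. *)
exists (Num.min 1 (e / (c + 1))); rewrite lt_min ltr01 divr_gt0//; split => //.
set U := Num.min _ _.
have U1 : U <= 1 by rewrite ge_min lexx.
have : U * (c + 1) <= e by rewrite -ler_pdivlMr// ge_min lexx orbT.
have U0 : 0 < U by rewrite lt_min ltr01 divr_gt0.
nra.
Qed.

Lemma sup_norm_closable_bdd_part : sup_norm_closable B E.
Proof.
move=> u Bu uC u0 e e0.
have [|N hN] := uC (e / 8); first lra.
exists N => m Nm; have bm := BL (Bu m).
rewrite ger0_norm; last exact/(form_ge0 FE)/BF.
(* [form_of_aform] and [aform_le_of_lam] reduce this to bounding [lam] of [u m] by e / 2 for every b
   and every integrable weight k with values in [0, 1]. *)
suff [_ h _] : [/\ F (u m), E (u m) (u m) <= e / 2 & forall e' : R, 0 < e' -> exists N,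
    forall n, (N <= n)%N ->
    E (fun x => res mu F E n.+1%:R (u m) x - u m x)
      (fun x => res mu F E n.+1%:R (u m) x - u m x) < e'] by lra.
apply: (form_of_aform HD bm.1) => j; have j0 : (0 : R) < j.+1%:R by rewrite ltr0n.
move: (j.+1%:R) j0 => b b0.
apply: (aform_le_of_lam HD b0 bm) => k bk k01 Ik.
have k0 x := (andP (k01 x)).1.
apply/ler_addgt0Pl => t t0.
have Ik0 : 0 <= \int[mu]_x k x by apply: Rintegral_ge0 => x _.
(* Once |u_n| <= U, twice [lam] of [u n] at k is at most 8 b U^2 times the integral of k, hence
   below t. Twice [lam] of u_m - u_n is at most 4 E(u_m - u_n) < e / 2, which explains the initial e
   / 8. *)
have [||U [U0 hU]] := @sq_small (8 * b * \int[mu]_x k x) t => //.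
  by rewrite !mulr_ge0// ltW.
have [N' hN'] := u0 _ U0; pose n := maxn N N'.
have := lam_sub_le HD b0 bm (BL (Bu n)) bk k0.
have := lam_le_sup HD b0 (BL (Bu n)) (hN' n (leq_maxr _ _)) bk k0 Ik.
have Bd := form_subP Blin (Bu m) (Bu n).
have := lam_le HD b0 ler01 (BL Bd) bk (fun x => (andP (k01 x)).2).
have := aform_le HD b0 (BF Bd); have := hN m n Nm (leq_maxl _ _).
lra.
Qed.

(** By closedness (u_n) converges to some v in F for E + |.|^2. Since u_n -> 0 in L2, v = 0 almost
    everywhere, and so E(u_n) = E(u_n - v). *)
Lemma dirichlet_closable u : (forall n, F (u n)) ->
  (forall e : R, 0 < e -> exists N, forall n m, (N <= n)%N -> (N <= m)%N ->
     E (fun x => u n x - u m x) (fun x => u n x - u m x) < e) ->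
  (forall e : R, 0 < e -> exists N, forall n, (N <= n)%N -> ip (u n) (u n) < e) ->
  forall e : R, 0 < e -> exists N, forall n, (N <= n)%N -> E (u n) (u n) < e.
Proof.
move=> Fu uC u0.
have [|v [Fv vP]] := E1_complete HD (@ltr01 R) Fu.
  move=> e e0; have [|N1 h1] := uC (e / 2); first lra.
  have [|N2 h2] := u0 (e / 8); first lra.
  exists (maxn N1 N2) => n m; rewrite !geq_max => /andP[n1 n2] /andP[m1 m2].
  have := h1 _ _ n1 m1; have := h2 _ n2; have := h2 _ m2.
  have := form_sqB_le L20 L2lin ipE (FL2 (Fu n)) (FL2 (Fu m)).
  by rewrite /E1 mul1r; lra.
have v0 : ae_eq mu setT v (fun=> 0).
  apply: ip_eq0; first exact: FL2.
  apply/ler_addgt0Pl => e e0; rewrite addr0.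
  have [|N1 h1] := u0 (e / 4); first lra.
  have [|N2 h2] := vP (e / 4); first lra.
  pose n := maxn N1 N2.
  have := h1 n (leq_maxl _ _); have := h2 n (leq_maxr _ _); rewrite /E1 mul1r.
  have := form_ge0 FE (form_subP Flin (Fu n) Fv).
  have := form_le2B L20 L2lin ipE (FL2 Fv) (FL2 (Fu n)).
  rewrite (form_subC L20 L2lin ipE (FL2 Fv) (FL2 (Fu n))); lra.
move=> e /vP[N hN]; exists N => n /hN; apply: le_lt_trans.
have -> : E (u n) (u n) = E (fun x => u n x - v x) (fun x => u n x - v x).
  apply: (dirichlet_eq_ae2 HD (Fu n) (form_subP Flin (Fu n) Fv)).
  by apply: filterS v0 => x h /h ->; rewrite subr0.
by rewrite /E1 lerDl mul1r (form_ge0 ipE (FL2 (form_subP Flin (Fu n) Fv))).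
Qed.

Section truncation.
Variables (h : T -> R) (t : R).
Hypothesis Bh : B h.
Hypothesis h0 : nonneg_fun h.
Hypothesis t0 : 0 < t.

Let low x := Num.min (h x) t.
Let high x := h x - low x.

Let Blow : B low.
Proof.
have nphi : normal_contraction (fun x : R => Num.min x t).
  split; first by rewrite min_l// ltW.
  move=> x y; have := ler_norm (x - y); have := ler_norm (- (x - y)); rewrite normrN ler_norml.
  by case: (leP x t) => ?; case: (leP y t) => ? ? ?; apply/andP; split; lra.
exact: (bdd_part_nc HD nphi Bh).1.
Qed.

(** Split h at height t. On the low part compare f with w and use that L_w is at most 2 t E(w, w)
    there; the high part is at most h^2 / t. *)
Lemma lagr_quad_split f w : B f -> B w ->
  L f h <= 2 * L (fun x => f x - w x) h + 4 * t * E w w + t^-1 * L f (fun x => h x * h x).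
Proof.
move=> Bf Bw; have Bhigh := form_subP Blin Bh Blow.
have Bhh := bdd_part_mul HD Bh Bh; have Bd := form_subP Blin Bf Bw.
have low0 : nonneg_fun low by move=> x; rewrite le_min h0 ltW.
have -> : L f h = L f low + L f high.
  by rewrite -(lagr_quadD HD)//; congr (L f _); rewrite /high; fring.
(* [high] vanishes where h <= t, and elsewhere it is at most h <= h^2 / t. *)
have : L f high <= t^-1 * L f (fun x => h x * h x).
  rewrite -(lagr_quadZ HD)//; apply: (lagr_quad_mono HD Bf Bhigh).
    exact: (bdd_part_scale HD).
  move=> x; rewrite mulrC ler_pdivlMr// /high /low.
  have := h0 x; case: (leP (h x) t) => ? ?; nra.
have := form_le2B B0 Blin (lagr_form_on HD Blow low0) Bf Bw.
rewrite !(lagr_of_diag HD)//.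
have : L (fun x => f x - w x) low <= L (fun x => f x - w x) h.
  by apply: (lagr_quad_mono HD Bd Blow Bh) => x; rewrite ge_min lexx.
have : L w low <= 2 * t * E w w.
  by apply: (lagr_quad_le HD (ltW t0) Bw Blow) => x; rewrite ge_min lexx orbT.
lra.
Qed.

End truncation.

Lemma sup_norm_closable_lagr_bdd_part : sup_norm_closable_lagr B (lagr_of E).
Proof.
move=> h Bh h0 u Bu uC u0.
have Bd n m := form_subP Blin (Bu n) (Bu m).
have {}uC (e : R) : 0 < e -> exists N, forall n m, (N <= n)%N -> (N <= m)%N ->
    L (fun x => u n x - u m x) h < e.
  move=> /uC[N hN]; exists N => n m Nn Nm.
  by rewrite -(lagr_of_diag HD (Bd n m) Bh); exact: hN.
have [_ [M hM] _] := Bh; pose H := `|M| + 1.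
have hH x : 0 <= h x <= H.
  rewrite h0/= (le_trans (ler_norm _))// (le_trans (hM x))// (le_trans (ler_norm M))//.
  by rewrite /H lerDl.
have H0 : 0 < H by rewrite ltr_wpDl.
have Eh0 : 0 <= E h h := form_ge0 FE (BF Bh).
have ih0 : 0 <= ip h h := form_ge0 ipE (FL2 (BF Bh)).
pose w n x := u n x * h x; have Bw n : B (w n) := bdd_part_mul HD (Bu n) Bh.
have Ew := @dirichlet_closable w (fun n => BF (Bw n)).
(* The products u_n h are E-Cauchy by [form_mul_le], applied with |u_n - u_m| <= 2 U (whence the
   factor 16), and tend to 0 in L2 since |u_n h| <= U h. *)
have {}Ew (e : R) : 0 < e -> exists N, forall n, (N <= n)%N -> E (w n) (w n) < e.
  apply: Ew => [t t0|t t0].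
    have [|N1 h1] := uC (t / (4 * H)); first by rewrite divr_gt0// mulr_gt0.
    have [||U [U0 hU]] := @sq_small (16 * E h h) (t / 2); [by rewrite mulr_ge0|lra|].
    have [N2 h2] := u0 _ U0.
    exists (maxn N1 N2) => n m; rewrite !geq_max => /andP[n1 n2] /andP[m1 m2].
    have := h1 n m n1 m1; rewrite ltr_pdivlMr ?mulr_gt0// => h1'.
    have dU x : `|u n x - u m x| <= 2 * U.
      rewrite (le_trans (ler_normB _ _))//; have := h2 n n2 x; have := h2 m m2 x; lra.
    have := form_mul_le HD (Bd n m) Bh dU hH.
    rewrite (_ : (fun x => (u n x - u m x) * h x) = (fun x => w n x - w m x)); last first.
      by rewrite /w; fring.
    lra.
  have [//||U [U0 hU]] := @sq_small (ip h h) t; first by [].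
  have [N hN] := u0 _ U0; exists N => n Nn; apply: le_lt_trans hU.
  have Lh := FL2 (BF Bh); have LUh := form_scaleP L20 L2lin U Lh.
  rewrite expr2 -mulrA -(formZr L20 L2lin ipE U Lh Lh) -(formZl L20 ipE U Lh LUh).
  apply: ip_mono => //; [exact: (FL2 (BF (Bw n)))..|].
  apply: aeW => x; rewrite /w -!expr2 !exprMn ler_wpM2r ?sqr_ge0//.
  by rewrite -real_normK ?num_real// lerXn2r// ?nnegrE ?(ltW U0)//; exact: hN.
move=> e e0.
(* Order of choices: first the reference function [u N1], then t small in terms of its energy, and
   only then n so large that L_{u_n}(h^2) <= t e / 4. The three terms of [lagr_quad_split] are then
   at most e / 8, e / 4 and e / 4. *)
have [|N1 h1] := uC (e / 16); first lra.
have E10 := form_ge0 FE (BF (Bu N1)).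
pose t := e / (16 * (E (u N1) (u N1) + 1)).
have t0 : 0 < t by rewrite divr_gt0// mulr_gt0//; lra.
have tE : 4 * t * E (u N1) (u N1) <= e / 4.
  have -> : 4 * t * E (u N1) (u N1) = e / 4 * (E (u N1) (u N1) / (E (u N1) (u N1) + 1)).
    by rewrite /t; field; rewrite gt_eqF//; lra.
  by rewrite ler_piMr; [|lra|rewrite ler_pdivrMr; lra].
have [|N2 h2] := Ew (t * (e / 32)); first by rewrite mulr_gt0//; lra.
have [||U [U0 hU]] := @sq_small (4 * E h h) (t * (e / 8)).
- by rewrite mulr_ge0.
- by rewrite mulr_gt0//; lra.
have [N3 h3] := u0 _ U0.
exists (maxn N1 (maxn N2 N3)) => n; rewrite !geq_max => /andP[n1 /andP[n2 n3]].
rewrite (lagr_of_diag HD (Bu n) Bh) ger0_norm; last exact: (lagr_quad_ge0 HD (Bu n) Bh h0).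
have := lagr_quad_split Bh h0 t0 (Bu n) (Bu N1).
have := h1 n N1 n1 (leqnn _).
have := lagr_quad_sq_le HD (Bu n) Bh (h3 n n3); rewrite -/(w n).
have := h2 n n2.
set q := L (u n) (fun x => h x * h x) => a1 a2 a3 a4.
have : t^-1 * q <= e / 4.
  by rewrite mulrC ler_pdivrMr//; lra.
lra.
Qed.

End Closability.

Unset Implicit Arguments.

Theorem theoremT (R : realType) (d : measure_display) (T : measurableType d)
  (mu : {measure set T -> \bar R}) (F : set (T -> R))
  (E : (T -> R) -> (T -> R) -> R) :
  sigma_finite setT mu ->
  is_dirichlet_form mu F E ->
  [/\ is_lagrangian (bdd_part F) (lagr_of E),
      sup_norm_closable_lagr (bdd_part F) (lagr_of E)
    & nc_operate_lagr (bdd_part F) (lagr_of E)] /\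
  [/\ is_bilinear_form (bdd_part F) E,
      sup_norm_closable (bdd_part F) E
    & nc_operate_form (bdd_part F) E].
Proof.
move=> _ HD; split; split.
- exact: (is_lagrangian_bdd_part HD).
- exact: (sup_norm_closable_lagr_bdd_part HD).
- exact: (nc_operate_lagr_bdd_part HD).
- case: (dirichlet_form_on HD) => EC El E0; split.
  + by move=> f g /bdd_part_F Ff /bdd_part_F Fg; exact: EC.
  + by move=> a f f' g /bdd_part_F Ff /bdd_part_F Ff' /bdd_part_F Fg; exact: El.
  + by move=> f /bdd_part_F Ff; exact: E0.
- exact: (sup_norm_closable_bdd_part HD).
- by move=> phi f nphi Bf; exact: (bdd_part_nc HD nphi Bf).
Qed.
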